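(* Let $\gamma>0$ and $(u_0,u_1)\in D(A)\times D(A^{1/2})$ with $u_0\neq 0$, and let $\lambda\ge\nu$. Then there exists $\varepsilon_0>0$ (depending on $\lambda$) such that for every $\varepsilon\in(0,\varepsilon_0]$ the global solution $u_\varepsilon$ of $$\varepsilon u_\varepsilon''(t)+|A^{1/2}u_\varepsilon(t)|^{2\gamma}Au_\varepsilon(t)+u_\varepsilon'(t)=0\quad (t\ge 0),\qquad u_\varepsilon(0)=u_0,\quad u_\varepsilon'(0)=u_1,$$ satisfies the following. 1. For $h=0,1$ there exist constants $\gamma_{h,\lambda}$, independent of $\varepsilon$, such that $$e^{2\lambda^2B_\varepsilon(t)}\left(\varepsilon\frac{|A^{h/2}U_{\varepsilon,\lambda}'(t)|^2}{b_\varepsilon(t)}+|A^{(h+1)/2}U_{\varepsilon,\lambda}(t)|^2\right)\le\gamma_{h,\lambda}\qquad\forall t\ge 0.$$ 2. There exists a constant $\gamma_\lambda$, independent of $\varepsilon$, such that $$e^{2\lambda^2B_\varepsilon(t)}\frac{|U_{\varepsilon,\lambda}'(t)|^2}{b_\varepsilon^2(t)}\le\gamma_\lambda\qquad\forall t\ge 0.$$ 3. There exists a constant $\gamma_{\varepsilon,\lambda}$ (possibly depending on $\varepsilon$) such that $$e^{2\lambda^2B_\varepsilon(t)}\frac{|U_{\varepsilon,\lambda}''(t)-\Theta_{\varepsilon,\lambda}''(t)|^2}{b_\varepsilon^4(t)}\le\gamma_{\varepsilon,\lambda}\qquad\forall t\ge 0.$$ Moreover, if $(u_0,u_1)\in D(A^2)\times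 D(A^{3/2})$, then $\gamma_{\varepsilon,\lambda}$ can also be taken independent of $\varepsilon$.
   Context: $H$ is a real Hilbert space with norm $|\cdot|$ and scalar product $\langle\cdot,\cdot\rangle$. $A$ is a self-adjoint linear operator on $H$ with dense domain $D(A)$, coercive: $\langle Au,u\rangle\ge\sigma_0|u|^2$ for all $u\in D(A)$, for some $\sigma_0>0$. $H$ has a countable (orthonormal) basis $(e_k)_k$ of eigenvectors of $A$, $Ae_k=\lambda_k^2e_k$ with $\lambda_k>0$; for $u\in H$ write $u=\sum_k u_ke_k$, and write $u_{0,k},u_{1,k}$ for the components of $u_0,u_1$. Set $\nu:=\min\{\lambda_k:\ u_{0,k}\ne0\text{ or }u_{1,k}\neq 0\}$ (the minimum is understood to be attained). For $\lambda>0$, $H_\lambda:=\{u\in H: u=\sum_{k:\lambda_k\ge\lambda}u_ke_k\}$, $A_\lambda$ is the restriction of $A$ to $H_\lambda$, and for $u\in H$ its component in $H_\lambda$ is $U_\lambda:=\sum_{k:\lambda_k\ge\lambda}u_ke_k$. Thus $U_{\varepsilon,\lambda}(t)$, $U_{0,\lambda}$, $U_{1,\lambda}$ denote the components in $H_\lambda$ of $u_\varepsilon(t)$, $u_0$, $u_1$ respectively. Known fact (recalled from the literature): for $\varepsilon$ small the Cauchy problem has a unique global solution $u_\varepsilon\in C^2([0,+\infty),H)\cap C^1([0,+\infty),D(A^{1/2}))\cap C^0([0,+\infty),D(A))$, and there are constants $K_1,K_2>0$ independent of $\varepsilon$ such that for all $t\ge0$: $K_1(1+t)^{-1/\gamma}\le|A^{1/2}u_\varepsilon(t)|^2\le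 K_2(1+t)^{-1/\gamma}$, $K_1(1+t)^{-1/\gamma}\le|Au_\varepsilon(t)|^2\le K_2(1+t)^{-1/\gamma}$, $|u_\varepsilon'(t)|^2\le K_2(1+t)^{-2-1/\gamma}$. It is always assumed that $\varepsilon\le1$ is small enough for this to hold, and $u_\varepsilon$ denotes this solution. Define $b_\varepsilon(t):=|A^{1/2}u_\varepsilon(t)|^{2\gamma}$ (which is positive), $b_0:=b_\varepsilon(0)=|A^{1/2}u_0|^{2\gamma}$, and $B_\varepsilon(t):=\int_0^tb_\varepsilon(s)\,ds$. The corrector $\Theta_{\varepsilon,\lambda}:[0,+\infty)\to H_\lambda$ is the solution of $\varepsilon\Theta_{\varepsilon,\lambda}''+\Theta_{\varepsilon,\lambda}'=0$, $\Theta_{\varepsilon,\lambda}(0)=0$, $\Theta_{\varepsilon,\lambda}'(0)=U_{1,\lambda}+b_0A_\lambda U_{0,\lambda}$. ''Independent of $\varepsilon$'' means the same constant works for all $\varepsilon\in(0,\varepsilon_0]$; constants may depend on $A$, $\gamma$, $\lambda$, $u_0$, $u_1$. *)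

(* Defs.v *)
From HB Require Import structures.
From mathcomp Require Import all_boot all_order all_algebra sesquilinear.
From mathcomp Require Import all_classical all_reals all_analysis.

Set Implicit Arguments.
Unset Strict Implicit.
Unset Printing Implicit Defensive.
Import Order.TTheory GRing.Theory Num.Theory.
Import numFieldNormedType.Exports.
Local Open Scope classical_set_scope.
Local Open Scope ring_scope.

Section HalfLine.
Context (R : realType) (H : normedModType R).
Implicit Types (f : R -> H) (t : R) (D : set H) (T : H -> H).

Definition half_line : set R := `[0, +oo[.

(* The derivative along [0, +oo[ (one-sided at 0): only the values of f on
   [0, +oo[ matter, f being arbitrary on negative times. *)
Definition quotient f t (s : R) : H := (s - t)^-1 *: (f s - f t).

Definition hderivable f t : Prop :=
  cvg (quotient f t @ within half_line t^').

Definition hderiv f t : H := lim (quotient f t @ within half_line t^').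

Definition is_C0 f : Prop := {within half_line, continuous f}.

Definition is_C1 f : Prop :=
  (forall t, 0 <= t -> hderivable f t) /\ is_C0 (hderiv f).

Definition is_C2 f : Prop := is_C1 f /\ is_C1 (hderiv f).

(* C^0 and C^1 regularity with values in the domain D of a closed operator T,
   normed by the graph norm: f(t) converges in D iff both f(t) and T f(t)
   converge in H and the limit is in D. *)
Definition is_C0_dom D T f : Prop :=
  [/\ forall t, 0 <= t -> D (f t), is_C0 f & is_C0 (T \o f)].

Definition is_C1_dom D T f : Prop :=
  [/\ forall t, 0 <= t ->
        [/\ D (f t), D (hderiv f t), hderivable f t,
            hderivable (T \o f) t & hderiv (T \o f) t = T (hderiv f t)],
      is_C0 (hderiv f) & is_C0 (T \o hderiv f)].

End HalfLine.

Section Operators.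
Context (R : realType) (H : completeNormedModType R) (ip : {dot H for idfun}).
Implicit Types (DA : set H) (A : H -> H).

(* H is a Hilbert space: it is complete and its norm comes from ip. *)
Definition norm_from_ip : Prop := forall u : H, `|u| ^+ 2 = ip u u.

(* An unbounded operator is a domain DA together with a function A that is
   meaningful on DA only. *)
Definition linear_on DA A : Prop :=
  forall (a : R) u v, DA u -> DA v ->
    DA (a *: u + v) /\ A (a *: u + v) = a *: A u + A v.

Definition adjoint_dom DA A : set H :=
  [set v | exists w, forall u, DA u -> ip (A u) v = ip u w].

Definition self_adjoint DA A : Prop :=
  [/\ linear_on DA A, dense DA, DA = adjoint_dom DA A &
      forall u v, DA u -> DA v -> ip (A u) v = ip u (A v)].

Definition coercive DA A : Prop :=
  exists2 sigma0 : R, 0 < sigma0 &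
    forall u, DA u -> sigma0 * `|u| ^+ 2 <= ip (A u) u.

(* The eigenbasis is (e k) for k : nat with K k, so that both finite and
   countably infinite bases are covered. *)
Context (K : pred nat) (e : nat -> H) (lambda : nat -> R).

Definition orthonormal_basis : Prop :=
  (forall j k, K j -> K k -> ip (e j) (e k) = (j == k)%:R) /\
  (forall u, (fun n => \sum_(0 <= k < n | K k) ip u (e k) *: e k) @ \oo --> u).

Definition eigenbasis DA A : Prop :=
  orthonormal_basis /\
  forall k, K k -> [/\ 0 < lambda k, DA (e k) & A (e k) = lambda k ^+ 2 *: e k].

(* A^s u = \sum_k (lambda_k^2)^s u_k e_k, with domain D(A^s) the set of the u
   for which the series converges in H. *)
Definition pow_partial (s : R) (u : H) (n : nat) : H :=
  \sum_(0 <= k < n | K k) ((lambda k ^+ 2) `^ s * ip u (e k)) *: e k.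

Definition pow_dom (s : R) : set H := [set u | cvg (pow_partial s u @ \oo)].

Definition pow_op (s : R) (u : H) : H := lim (pow_partial s u @ \oo).

Definition high_partial (lam : R) (u : H) (n : nat) : H :=
  \sum_(0 <= k < n | K k && (lam <= lambda k)) ip u (e k) *: e k.

Definition high_space (lam : R) : set H :=
  [set u | high_partial lam u @ \oo --> u].

Definition high (lam : R) (u : H) : H := lim (high_partial lam u @ \oo).

Definition frequencies (u0 u1 : H) : set R :=
  [set lambda k | k in
     [set k | K k /\ (ip u0 (e k) != 0 \/ ip u1 (e k) != 0)]].

Definition kirchhoff (gam : R) (v : H) : R := `|pow_op (1/2) v| `^ (2 * gam).

Definition primitive (b : R -> R) (t : R) : R :=
  \int[@lebesgue_measure R]_(s in `[0, t]) b s.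

Definition solution DA A (gam eps : R) (u0 u1 : H) (u : R -> H) : Prop :=
  [/\ [/\ is_C2 u, is_C1_dom (pow_dom (1/2)) (pow_op (1/2)) u &
          is_C0_dom DA A u],
      forall t, 0 <= t ->
        eps *: hderiv (hderiv u) t + kirchhoff gam (u t) *: A (u t)
          + hderiv u t = 0,
      u 0 = u0 & hderiv u 0 = u1].

Definition decay A (gam K1 K2 : R) (u : R -> H) : Prop :=
  forall t, 0 <= t ->
    [/\ K1 * (1 + t) `^ (- (1 / gam)) <= `|pow_op (1/2) (u t)| ^+ 2
          <= K2 * (1 + t) `^ (- (1 / gam)),
        K1 * (1 + t) `^ (- (1 / gam)) <= `|A (u t)| ^+ 2
          <= K2 * (1 + t) `^ (- (1 / gam)) &
        `|hderiv u t| ^+ 2 <= K2 * (1 + t) `^ (- 2 - 1 / gam)].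

Definition corrector A (gam lam eps : R) (u0 u1 : H) (Theta : R -> H) : Prop :=
  [/\ is_C2 Theta /\ (forall t, 0 <= t -> high_space lam (Theta t)),
      forall t, 0 <= t -> eps *: hderiv (hderiv Theta) t + hderiv Theta t = 0,
      Theta 0 = 0 &
      hderiv Theta 0 = high lam u1 + kirchhoff gam u0 *: A (high lam u0)].

End Operators.

(* Main.v *)
Require Import Defs.
From HB Require Import structures.
From mathcomp Require Import all_boot all_order all_algebra sesquilinear.
From mathcomp Require Import all_classical all_reals all_analysis.
From mathcomp Require Import ring lra.

Set Implicit Arguments.
Unset Strict Implicit.
Unset Printing Implicit Defensive.
Import Order.TTheory GRing.Theory Num.Theory.
Import numFieldNormedType.Exports.
Local Open Scope classical_set_scope.
Local Open Scope ring_scope.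

(** Expand the solution in the eigenbasis: the component [y] of [u_eps] along
    an eigenvector of eigenvalue [mu = lambda_k ^ 2] solves the scalar equation
    [eps y'' + y' + b(t) mu y = 0]. The only nonlinear feature is that [b] is
    produced by the whole solution, but the known decay estimates say all that
    is needed about it, uniformly in [eps]: [b] is comparable to [1 / (1 + t)],
    and [|b'| <= C b^2] by the Cauchy-Schwarz inequality
    ([kirchhoff_damping]). It therefore suffices to estimate one mode, with
    constants depending neither on [eps] nor on [mu >= m := lam ^ 2], and to
    add up the squares of the estimates by Parseval's identity.

    Energy of a mode ([mode_energy_bound]). The decay rate must be exactly
    [e^(- m B)], without loss, even for modes with [mu = m]. Put
    [z = e^(m B) y]. Then [z] solves
    [eps z'' + (1 - 2 eps m b) z' + (b (mu - m) + eps (m^2 b^2 - m b')) z = 0],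
    in which the zeroth-order terms caused by [e^(m B)] are of size [eps b^2]. The energy
    [eps z'^2 / b + (mu - m) z^2], completed by [eps z z' + z^2 / 2] so as to
    control [z] itself when [mu = m], grows at most like
    [exp (const * int b^2)], and [b^2 <= const / (1 + t)^2] is integrable.
    Hence [e^(2 m B) (eps y'^2 / b + mu y^2)] is bounded by the data
    [eps y'(0)^2 + mu y(0)^2]; multiplied by [mu^h] and summed, this is the
    first assertion.

    Derivatives ([mode_velocity_bound], [mode_acceleration_bound]). Both
    [e^(m B) y' / b] and [e^(m B) (y'' - theta'') / b^2] solve a relaxation
    equation [eps s' + a s = f] with [a >= 1/2], so that they stay below their
    initial size plus twice the size of [f] ([relaxation_bound]). For the first
    one [f = - mu e^(m B) y] is controlled by the energy. For the second one
    the corrector makes the initial value vanish, which removes the factor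
    [1 / eps] present in [y''(0)], and [f] involves [mu y' / b]: that is why
    more regular data are needed for uniformity in [eps].

    Data in [D(A) x D(A^(1/2))] ([mode_acceleration_data_bound]). With a
    constant depending on [eps] no further regularity is needed. Choose [p] so
    large that [e^(2 p B)] dominates [(1 + t)^4], hence [b^(-4)]. For
    [mu < m + p] the previous estimate is fine because [mu] is bounded. For
    [mu >= m + p] the energy decays at the faster rate [e^(- 2 (m + p) B)],
    which pays for the weight [b^(-4)], so that it is enough to read [y''] off
    the equation. *)

(** [sqr_ge0] comes first because [x ^+ 2] also unifies with a product, whose
    factors have no sign; quotients precede products because a bare inverse is
    not treated. *)
Ltac nonneg := repeat first
  [ exact: sqr_ge0 | exact: expR_ge0 | by [] | by apply: ltW
  | apply: divr_ge0 | apply: mulr_ge0 | apply: addr_ge0 | apply: exprn_ge0 ].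

(** * Functions on the half-line, differentiable at positive times *)

Section Evolution.
Context (R : realType).
Implicit Types (f g : R -> R) (t : R).

(** The regularity that monotonicity arguments on [0, +oo[ require: [f'] is an
    ordinary two-sided derivative away from 0, and at 0 only continuity from
    the right is asked, as [f] is arbitrary on negative times. *)
Definition evolves f f' : Prop :=
  (forall t, 0 < t -> is_derive t (1 : R) f (f' t)) /\
  (forall t, 0 <= t -> f @ within (@half_line R) (nbhs t) --> f t).

Lemma evolves_eq f f' g' : evolves f f' ->
  (forall t, 0 < t -> f' t = g' t) -> evolves f g'.
Proof.
by move=> [df cf] E; split=> // t t0; apply: is_derive_eq (df t t0) (E t t0).
Qed.

Lemma evolves_cst (c : R) : evolves (fun=> c) (fun=> 0).
Proof. by split=> t _; [exact: is_derive_cst|exact: cvg_cst]. Qed.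

Lemma evolves_id : evolves id (fun=> 1).
Proof.
split=> t _; first exact: is_derive_id.
by apply: cvg_within_filter; exact: cvg_id.
Qed.

Lemma evolvesD f f' g g' : evolves f f' -> evolves g g' ->
  evolves (fun t => f t + g t) (fun t => f' t + g' t).
Proof.
move=> [df cf] [dg cg]; split=> t t0.
  exact: (is_deriveD (df t t0) (dg t t0)).
exact: cvgD (cf t t0) (cg t t0).
Qed.

Lemma evolvesM f f' g g' : evolves f f' -> evolves g g' ->
  evolves (fun t => f t * g t) (fun t => f' t * g t + f t * g' t).
Proof.
move=> [df cf] [dg cg]; split=> t t0.
  apply: is_derive_eq (is_deriveM (df t t0) (dg t t0)) _.
  by rewrite /GRing.scale /= addrC [g t * _]mulrC.
exact: cvgM (cf t t0) (cg t t0).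
Qed.

Lemma evolvesN f f' : evolves f f' -> evolves (fun t => - f t) (fun t => - f' t).
Proof.
move=> [df cf]; split=> t t0; first exact: (is_deriveN (df t t0)).
exact: cvgN (cf t t0).
Qed.

Lemma evolvesB f f' g g' : evolves f f' -> evolves g g' ->
  evolves (fun t => f t - g t) (fun t => f' t - g' t).
Proof. by move=> ef eg; exact: evolvesD ef (evolvesN eg). Qed.

Lemma evolvesZ c f f' : evolves f f' ->
  evolves (fun t => c * f t) (fun t => c * f' t).
Proof.
move=> ef; apply: evolves_eq (evolvesM (evolves_cst c) ef) _ => t _.
by rewrite mul0r add0r.
Qed.

Lemma evolvesV f f' : (forall t, 0 <= t -> f t != 0) -> evolves f f' ->
  evolves (fun t => (f t)^-1) (fun t => - (f t ^- 2 * f' t)).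
Proof.
move=> f0 [df cf]; split=> t t0; last exact: cvgV (f0 t t0) (cf t t0).
have ft0 := f0 t (ltW t0); have d := df t t0.
apply: DeriveDef; first by apply: derivableV => //; case: d.
rewrite deriveV //.
by rewrite (@derive_val _ _ _ _ _ _ _ d) /GRing.scale /= mulNr.
Qed.

Lemma evolves_comp (h h' : R -> R) f f' :
  (forall t, 0 <= t -> is_derive (f t) (1 : R) h (h' (f t))) -> evolves f f' ->
  evolves (fun t => h (f t)) (fun t => h' (f t) * f' t).
Proof.
move=> dh [df cf]; split=> t t0.
  have := @is_derive1_comp R h f t _ _ (dh t (ltW t0)) (df t t0).
  done.
have [dht _] := dh t t0.
apply: continuous_cvg (cf t t0).
by apply: differentiable_continuous; apply/derivable1_diffP.
Qed.

Lemma evolves_exp f f' : evolves f f' ->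
  evolves (fun t => expR (f t)) (fun t => expR (f t) * f' t).
Proof. by apply: evolves_comp => t _; exact: is_derive_expR. Qed.

Lemma evolves_nincr f f' : evolves f f' ->
  (forall t, 0 < t -> f' t <= 0) -> forall t, 0 <= t -> f t <= f 0.
Proof.
move=> [df cf] f'0 t t0.
have sub : `[0, t]%classic `<=` @half_line R.
  by move=> s; rewrite /half_line /= !in_itv /= => /andP[->].
apply: (@ler0_derive1_nincr _ f 0 t) => //.
- by move=> s; rewrite in_itv /= => /andP[s0 _]; case: (df s s0).
- move=> s; rewrite in_itv /= => /andP[s0 _]; rewrite derive1E.
  by rewrite (@derive_val _ _ _ _ _ _ _ (df s s0)); exact: f'0.
- apply: (continuous_subspaceW sub).
  apply/subspace_continuousP => s; rewrite /half_line /= in_itv /= andbT.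
  exact: cf.
Qed.

End Evolution.

(** * Differential inequalities *)

Section Scalar.
Context (R : realType).
Implicit Types (f g w s : R -> R) (t : R).

(** [e^(- w) f] is nonincreasing. The sign of [f] is free. *)
Lemma evolves_gronwall f f' w w' : evolves f f' -> evolves w w' ->
  (forall t, 0 < t -> f' t <= w' t * f t) ->
  forall t, 0 <= t -> f t <= expR (w t - w 0) * f 0.
Proof.
move=> ef ew ff' t t0.
have eg := evolvesM (evolves_exp (evolvesN ew)) ef.
have H : expR (- w t) * f t <= expR (- w 0) * f 0.
  apply: (evolves_nincr eg) t0 => r r0.
  rewrite mulrN mulNr -mulrA addrC -mulrBr pmulr_rle0 ?expR_gt0//.
  by rewrite subr_le0; exact: ff'.
rewrite -(ler_pM2l (expR_gt0 (- w t))) (le_trans H)// mulrA -expRD.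
by rewrite (_ : - w t + (w t - w 0) = - w 0)//; ring.
Qed.

(** The equation pulls [s] towards [f / a], of size at most [2 sqrt M]:
    the excess of [s^2] over [4 M] is damped at rate [1 / (2 eps)]. *)
Lemma relaxation_bound (eps M : R) s s' (a f : R -> R) : 0 < eps -> 0 <= M ->
  evolves s s' ->
  (forall t, 0 < t -> [/\ eps * s' t + a t * s t = f t, 1 / 2 <= a t &
                          f t ^+ 2 <= M]) ->
  forall t, 0 <= t -> s t ^+ 2 <= s 0 ^+ 2 + 4 * M.
Proof.
move=> e0 M0 es H t t0.
have eG := evolvesB (evolvesM es es) (evolves_cst (4 * M)).
have ew := evolvesZ (- (2 * eps)^-1) (@evolves_id R).
have /= K := evolves_gronwall eG ew _ t0; move: K.
have : expR (- (2 * eps)^-1 * t - - (2 * eps)^-1 * 0) <= 1.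
  rewrite expR_le1 mulr0 subr0 mulNr oppr_le0; apply: mulr_ge0 => //.
  by rewrite invr_ge0; lra.
have := expR_gt0 (- (2 * eps)^-1 * t - - (2 * eps)^-1 * 0).
set E := expR _ => E0 E1 K.
have {}K : s t * s t - 4 * M <= E * (s 0 * s 0 - 4 * M).
  apply: K => r r0; have [eq ar fr] := H r r0.
  rewrite -(ler_pM2l e0) /= mulr1 mulrA mulrN.
  have -> : eps * (2 * eps)^-1 = 1 / 2 by field; rewrite gt_eqF.
  have -> : eps * (s' r * s r + s r * s' r - 0) =
    2 * s r * (f r - a r * s r) by rewrite -eq; ring.
  have : 0 <= (s r - 2 * f r) ^+ 2 by exact: sqr_ge0.
  have : 1 / 2 * s r ^+ 2 <= a r * s r ^+ 2 by rewrite ler_wpM2r ?sqr_ge0.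
  by rewrite !expr2 in fr *; lra.
have := sqr_ge0 (s 0); rewrite !expr2; nra.
Qed.

(** The derivative of the energy of the rescaled mode [z], written with
    [r = z' / b] and [q = b' / b^2] to avoid denominators. Once [eps z''] is
    eliminated, [- b r^2 (2 - ...)], negative by the smallness of [eps], absorbs
    the cross term in [r z]; what remains is of order [b^2 z^2]. *)
Lemma energy_dissipation (eps b p q r m C bet delta z z1 z2 : R) :
  0 < eps <= 1 -> 0 < b <= bet -> p = q * b ^+ 2 -> z1 = b * r ->
  `|q| <= C -> 0 <= m -> 0 <= delta ->
  16 * (eps * m * bet) <= 1 -> 16 * (eps * C * bet) <= 1 ->
  16 * (eps * bet) <= 1 ->
  eps * z2 + (1 - 2 * (eps * m * b)) * z1
    + (b * delta + eps * (m ^+ 2 * b ^+ 2 - m * p)) * z = 0 ->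
  2 * r * (eps * z2) - eps * r ^+ 2 * p + 2 * delta * z * z1
    + eps * z1 ^+ 2 + z * (eps * z2) + (1 - 2 * (eps * m * b)) * z * z1
    - eps * m * p * z ^+ 2
  <= (m ^+ 2 + m * C) ^+ 2 * bet * b ^+ 2 * z ^+ 2.
Proof.
move=> /andP[e0 e1] /andP[b0 bb] -> -> qC m0 d0 h1 h2 h3 eq.
have C0 : 0 <= C by apply: le_trans qC.
have -> : eps * z2 = - ((1 - 2 * (eps * m * b)) * (b * r)
    + (b * delta + eps * (m ^+ 2 * b ^+ 2 - m * (q * b ^+ 2))) * z).
  by apply/eqP; rewrite -subr_eq0 opprK addrA; apply/eqP.
(* eps g b^2 is the zeroth-order coefficient produced by the change of unknown. *)
set G := m ^+ 2 + m * C; pose g := m ^+ 2 - m * q.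
have gG : `|g| <= G.
  apply: le_trans (ler_normB _ _) _.
  by rewrite ger0_norm ?sqr_ge0// lerD2l normrM (ger0_norm m0) ler_wpM2l.
have gG2 : g ^+ 2 <= G ^+ 2.
  rewrite -[g ^+ 2]ger0_norm ?sqr_ge0// normrX.
  by rewrite lerXn2r ?nnegrE ?normr_ge0 //; apply: le_trans gG.
have emb : eps * m * b <= 1 / 16.
  have : eps * m * b <= eps * m * bet by apply: ler_wpM2l => //; apply: mulr_ge0 => //; lra.
  by lra.
have eb : eps * b <= 1 / 16.
  have : eps * b <= eps * bet by apply: ler_wpM2l => //; lra.
  by lra.
have eqb : - (1 / 16) <= eps * q * b.
  have : eps * `|q| * b <= eps * C * bet.
    by apply: ler_pM => //; [apply: mulr_ge0 => //; lra| lra | apply: ler_wpM2l => //; lra].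
  have : - (eps * q * b) <= eps * `|q| * b.
    rewrite -mulNr -mulrN; apply: ler_wpM2r; first exact: ltW.
    by apply: ler_wpM2l; [exact: ltW|rewrite -normrN ler_norm].
  by lra.
rewrite [leLHS](_ : _ = - (b * r ^+ 2) *
    (2 - 4 * (eps * m * b) + eps * q * b - eps * b)
  - 2 * eps * g * b ^+ 2 * r * z - b * delta * z ^+ 2
  - eps * m ^+ 2 * b ^+ 2 * z ^+ 2); last by rewrite /g; ring.
have H1 : b * r ^+ 2 <= b * r ^+ 2 *
    (2 - 4 * (eps * m * b) + eps * q * b - eps * b).
  by apply: ler_peMr; [apply: mulr_ge0; [exact: ltW|exact: sqr_ge0]|lra].
have H2 : 0 <= b * delta * z ^+ 2.
  by apply: mulr_ge0; [apply: mulr_ge0 => //; exact: ltW|exact: sqr_ge0].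
have H3 : 0 <= eps * m ^+ 2 * b ^+ 2 * z ^+ 2.
  apply: mulr_ge0 (sqr_ge0 _); apply: mulr_ge0 (sqr_ge0 _).
  by apply: mulr_ge0 (sqr_ge0 _); exact: ltW.
(* Completing this square absorbs the cross term 2 eps g b^2 r z. *)
have H4 : 0 <= b * (r + eps * g * b * z) ^+ 2.
  by apply: mulr_ge0; [exact: ltW|exact: sqr_ge0].
have H5 : eps ^+ 2 * g ^+ 2 * (b * b ^+ 2 * z ^+ 2)
    <= G ^+ 2 * (bet * b ^+ 2 * z ^+ 2).
  have bz : 0 <= b ^+ 2 * z ^+ 2 by apply: mulr_ge0; exact: sqr_ge0.
  apply: ler_pM.
  - by apply: mulr_ge0; exact: sqr_ge0.
  - by rewrite -mulrA; apply: mulr_ge0 => //; exact: ltW.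
  - rewrite -[G ^+ 2]mul1r; apply: ler_pM => //; try exact: sqr_ge0.
    by apply: exprn_ile1 => //; exact: ltW.
  - by rewrite -[leLHS]mulrA -[leRHS]mulrA; apply: ler_wpM2r.
have -> : G ^+ 2 * bet * b ^+ 2 * z ^+ 2 = G ^+ 2 * (bet * b ^+ 2 * z ^+ 2).
  by rewrite !mulrA.
have E4 : b * (r + eps * g * b * z) ^+ 2 = b * r ^+ 2
  + 2 * eps * g * b ^+ 2 * r * z + eps ^+ 2 * g ^+ 2 * (b * b ^+ 2 * z ^+ 2).
  by ring.
rewrite E4 in H4; rewrite mulNr.
lra.
Qed.

Lemma expR_double (x : R) : expR (2 * x) = expR x ^+ 2.
Proof. by rewrite expRM_natl. Qed.

Lemma sqr_add_le (x y : R) : (x + y) ^+ 2 <= 2 * x ^+ 2 + 2 * y ^+ 2.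
Proof. have := sqr_ge0 (x - y); rewrite !expr2; lra. Qed.

End Scalar.

(** * A single mode of the damped equation *)

Section Modes.
Context (R : realType).
Implicit Types (t : R).

(** What the decay estimates reveal of the coefficient [b = |A^(1/2) u|^(2 gam)]
    and of its primitive [B]. The constants [kap], [bet], [C] do not involve
    [eps]. Changing unknown to [e^(m B) y] produces terms of size [b^2] and
    [b']; both are integrable in time by [damping_upper] and [damping_var]. *)
Record damping (kap bet C : R) (b b' B : R -> R) : Prop := Damping {
  damping_kap : 0 < kap;
  damping_bet : 0 < bet;
  damping_C : 0 <= C;
  damping_lower : forall t, 0 <= t -> kap / (1 + t) <= b t;
  damping_upper : forall t, 0 <= t -> b t <= bet / (1 + t);
  damping_var : forall t, 0 < t -> `|b' t| <= C * b t ^+ 2;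
  damping_evolves : evolves b b';
  damping_int : evolves B b;
  damping_int0 : B 0 = 0 }.

(** The terms [eps m b], [eps b' / b] and [eps b] are then at most [1 / 16], a
    value small enough for all the absorptions below. *)
Definition small_eps (m bet C eps : R) : Prop :=
  [/\ 0 < eps <= 1, 16 * (eps * m * bet) <= 1, 16 * (eps * C * bet) <= 1 &
      16 * (eps * bet) <= 1].

Definition acceleration (eps mu : R) (b y y1 : R -> R) t : R :=
  - (y1 t + b t * mu * y t) / eps.

(** [y1] is the velocity of [y]; the equation is used in the form that gives
    the acceleration, so that [y''] is differentiable because [y], [y'] and [b]
    are. *)
Definition mode (eps mu : R) (b y y1 : R -> R) : Prop :=
  evolves y y1 /\ evolves y1 (acceleration eps mu b y y1).

Context (kap bet C : R) (b b' B : R -> R) (D : damping kap bet C b b' B).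

Lemma damping_gt0 t : 0 <= t -> 0 < b t.
Proof.
move=> t0; apply: lt_le_trans (damping_lower D t0).
by apply: divr_gt0 (damping_kap D) _; lra.
Qed.

Lemma damping_le t : 0 <= t -> b t <= bet.
Proof.
move=> t0; apply: le_trans (damping_upper D t0) _.
rewrite ler_pdivrMr; last by lra.
by have := damping_bet D; nra.
Qed.

Lemma damping_sqr_le t : 0 <= t -> b t ^+ 2 <= bet ^+ 2 / (1 + t) ^+ 2.
Proof.
move=> t0; rewrite -expr_div_n lerXn2r ?nnegrE ?(damping_upper D)//.
  exact/ltW/damping_gt0.
by apply: ltW; apply: divr_gt0 (damping_bet D) _; lra.
Qed.

Lemma damping_ratio t : 0 < t ->
  b' t = (b' t / b t ^+ 2) * b t ^+ 2 /\ `|b' t / b t ^+ 2| <= C.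
Proof.
move=> t0; have b0 := damping_gt0 (ltW t0).
have b2 : 0 < b t ^+ 2 by exact: exprn_gt0.
split; first by rewrite mulfVK// gt_eqF.
rewrite normrM normfV (ger0_norm (ltW b2)) ler_pdivrMr//.
exact: damping_var D _ t0.
Qed.

(** A bound for the logarithmic growth over [0, +oo[ of the completed energy:
    [b^2 <= bet^2 / (1 + t)^2] and [1 / (1 + t)^2] has integral 1. *)
Definition energy_growth (m : R) : R := 8 * (m ^+ 2 + m * C) ^+ 2 * bet ^+ 3.

Lemma energy_growth_ge0 m : 0 <= energy_growth m.
Proof.
rewrite /energy_growth mulr_ge0 ?exprn_ge0 ?(ltW (damping_bet D))//.
by rewrite mulr_ge0// sqr_ge0.
Qed.

(** [z] stands for [e^(m B) y] and [delta] for [mu - m], which may vanish: the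
    energy [eps z'^2 / b + delta z^2] is completed by
    [eps z z' + (1 - 2 eps m b) z^2 / 2], whose derivative is [eps z'^2] plus
    nonpositive terms, to obtain a functional that controls [z^2] uniformly in
    [delta]. *)
Lemma shifted_energy_bound (eps m delta : R) (z z1 z2 : R -> R) :
  small_eps m bet C eps -> 0 <= m -> 0 <= delta ->
  evolves z z1 -> evolves z1 z2 ->
  (forall t, 0 < t -> eps * z2 t + (1 - 2 * (eps * m * b t)) * z1 t
    + (b t * delta + eps * (m ^+ 2 * b t ^+ 2 - m * b' t)) * z t = 0) ->
  forall t, 0 <= t ->
    eps * z1 t ^+ 2 / b t / 2 + delta * z t ^+ 2 + z t ^+ 2 / 4 <=
    expR (energy_growth m) *
      (2 * eps * z1 0 ^+ 2 / b 0 + delta * z 0 ^+ 2 + 2 * z 0 ^+ 2).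
Proof.
move=> [/andP[e0 e1] h1 h2 h3] m0 d0 ez ez1 eq.
pose F t := eps * z1 t ^+ 2 / b t + delta * z t ^+ 2 + eps * z t * z1 t
   + (1 - 2 * (eps * m * b t)) * z t ^+ 2 / 2.
have small t : 0 <= t -> [/\ 0 <= eps * b t, eps * b t <= 1 / 16,
    0 <= eps * m * b t & eps * m * b t <= 1 / 16].
  move=> t0; have b0 := damping_gt0 t0; have bb := damping_le t0.
  have em0 : 0 <= eps * m by rewrite mulr_ge0// ltW.
  have : eps * b t <= eps * bet by rewrite ler_pM2l.
  have : eps * m * b t <= eps * m * bet by rewrite ler_wpM2l.
  by split; rewrite ?mulr_ge0 ?(ltW e0) ?(ltW b0)//; lra.
have kin0 t : 0 <= t -> 0 <= eps * z1 t ^+ 2 / b t.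
  move=> t0; apply: divr_ge0; last exact/ltW/damping_gt0.
  by apply: mulr_ge0 (sqr_ge0 _); exact: ltW.
have cross t : 0 <= t -> `|eps * z t * z1 t| <=
    eps * z1 t ^+ 2 / b t / 2 + z t ^+ 2 / 32.
  move=> t0; have b0 := damping_gt0 t0; have [_ sb _ _] := small t t0.
  have -> : eps * z1 t ^+ 2 / b t / 2 = eps * b t * (z1 t / b t) ^+ 2 / 2.
    by field; rewrite gt_eqF.
  have -> : eps * z t * z1 t = eps * b t * (z t * (z1 t / b t)).
    by field; rewrite gt_eqF.
  set r := z1 t / b t; have eb0 : 0 <= eps * b t by rewrite mulr_ge0 ?ltW.
  rewrite normrM (ger0_norm eb0).
  have zr : `|z t * r| <= (z t ^+ 2 + r ^+ 2) / 2.
    have := sqr_ge0 (z t - r); have := sqr_ge0 (z t + r).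
    by rewrite ler_norml; nra.
  have := ler_wpM2l eb0 zr; have := sqr_ge0 (z t); nra.
have lowerF t : 0 <= t ->
    eps * z1 t ^+ 2 / b t / 2 + delta * z t ^+ 2 + z t ^+ 2 / 4 <= F t.
  move=> t0; have [_ _ s0 s1] := small t t0; have := cross t t0.
  rewrite ler_norml => /andP[c1 c2]; rewrite /F.
  by have := sqr_ge0 (z t); nra.
have upperF0 : F 0 <= 2 * eps * z1 0 ^+ 2 / b 0 + delta * z 0 ^+ 2 + 2 * z 0 ^+ 2.
  have [_ _ s0 s1] := small 0 (lexx 0); have := cross 0 (lexx 0).
  rewrite ler_norml => /andP[c1 c2]; rewrite /F.
  have := kin0 0 (lexx 0).
  by have := sqr_ge0 (z 0); nra.
have zF t : 0 <= t -> z t ^+ 2 <= 8 * F t.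
  move=> t0; apply: le_trans (_ : 8 * (z t ^+ 2 / 8) <= _); first by lra.
  rewrite ler_pM2l//; apply: le_trans (lowerF t t0).
  have := kin0 t t0.
  have := mulr_ge0 d0 (sqr_ge0 (z t)); have := sqr_ge0 (z t); lra.
have bn0 t : 0 <= t -> b t != 0 by move=> t0; rewrite gt_eqF// damping_gt0.
have ebb := damping_evolves D.
have ez2 := evolvesM ez ez; have ez12 := evolvesM ez1 ez1.
have eF := evolvesD (evolvesD (evolvesD
   (evolvesZ eps (evolvesM ez12 (evolvesV bn0 ebb))) (evolvesZ delta ez2))
   (evolvesZ eps (evolvesM ez ez1)))
   (evolvesZ (1 / 2) (evolvesM (evolvesB (evolves_cst 1)
      (evolvesZ (2 * eps * m) ebb)) ez2)).
have t10 (s : R) : 0 <= s -> 1 + s != 0 by move=> s0; rewrite gt_eqF; lra.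
(* The exponent - energy_growth m / (1 + t) has derivative
   energy_growth m / (1 + t)^2 and varies by at most energy_growth m. *)
have ew := evolvesZ (- energy_growth m)
   (evolvesV t10 (evolvesD (evolves_cst 1) (@evolves_id R))).
move=> t t0; apply: le_trans (lowerF t t0) _.
apply: le_trans (_ : expR (energy_growth m) * F 0 <= _); last first.
  by rewrite ler_pM2l ?expR_gt0.
have E s : F s = eps * (z1 s * z1 s / b s) + delta * (z s * z s)
  + eps * (z s * z1 s) + 1 / 2 * ((1 - 2 * eps * m * b s) * (z s * z s)).
  by rewrite /F; ring.
have F0 : 0 <= F 0 by have := zF 0 (lexx 0); have := sqr_ge0 (z 0); lra.
rewrite E; apply: le_trans (evolves_gronwall eF ew _ t0) _; last first.
  rewrite /= -E; apply: ler_wpM2r => //; rewrite ler_expR.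
  rewrite addr0 invr1 mulr1 mulNr opprK gerDr oppr_le0.
  by rewrite mulr_ge0 ?energy_growth_ge0// invr_ge0; lra.
move=> s s0; have s0' := ltW s0; rewrite /= -E.
have [bq qC] := damping_ratio s0; have b0 := damping_gt0 s0'.
have z1b : z1 s = b s * (z1 s / b s) by rewrite mulrC mulfVK// gt_eqF.
have B1 : 0 < b s <= bet by rewrite b0 damping_le.
have E1 : 0 < eps <= 1 by rewrite e0 e1.
have := energy_dissipation E1 B1 bq z1b qC m0 d0 h1 h2 h3 (eq s s0).
set lhs := (X in X <= _) => dis.
rewrite [leLHS](_ : _ = lhs); last by rewrite /lhs; field; rewrite gt_eqF.
apply: le_trans dis _.
have bet0 := damping_bet D.
have K0 : 0 <= (m ^+ 2 + m * C) ^+ 2 * bet.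
  by rewrite mulr_ge0 ?sqr_ge0// ltW.
apply: le_trans (_ : (m ^+ 2 + m * C) ^+ 2 * bet * (bet ^+ 2 / (1 + s) ^+ 2)
   * (8 * F s) <= _).
  rewrite -[leLHS]mulrA -[leRHS]mulrA; apply: ler_wpM2l => //.
  apply: ler_pM; rewrite ?sqr_ge0 ?zF//.
  exact: damping_sqr_le.
rewrite le_eqVlt; apply/orP; left; apply/eqP.
by rewrite /energy_growth; field; rewrite gt_eqF; lra.
Qed.

Definition energy_const (m b0 : R) : R :=
  (4 + 5 * m) * expR (energy_growth m) * (4 / b0 + 1 + 2 / m).

Lemma energy_const_ge0 m : 0 < m -> 0 <= energy_const m (b 0).
Proof.
move=> m0; have b0 := damping_gt0 (lexx 0).
apply: mulr_ge0; first by rewrite mulr_ge0 ?expR_ge0//; lra.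
by rewrite !addr_ge0// divr_ge0 ?ltW.
Qed.

(** [shifted_energy_bound] for [z = e^(m B) y], translated back. The passage
    between [z'] and [e^(m B) y'] costs [m b z], harmless because
    [eps m b] is small and [z] itself is controlled. *)
Lemma mode_energy_bound (eps m mu : R) (y y1 : R -> R) :
  small_eps m bet C eps -> 0 < m <= mu -> mode eps mu b y y1 ->
  forall t, 0 <= t ->
    expR (2 * m * B t) * (eps * (y1 t ^+ 2 / b t) + mu * y t ^+ 2) <=
    energy_const m (b 0) * (eps * y1 0 ^+ 2 + mu * y 0 ^+ 2).
Proof.
move=> sm /andP[m0 mmu] [ey ey1] t t0.
have [/andP[e0 e1] h1 h2 h3] := sm.
have eE := evolves_exp (evolvesZ m (damping_int D)).
have ez := evolvesM eE ey.
have eby := evolvesM (damping_evolves D) ey.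
have ez1 := evolvesM eE (evolvesD ey1 (evolvesZ m eby)).
have {}ez : evolves (fun t => expR (m * B t) * y t)
    (fun t => expR (m * B t) * (y1 t + m * (b t * y t))).
  by apply: evolves_eq ez _ => s _; ring.
have delta0 : 0 <= mu - m by rewrite subr_ge0.
unshelve epose proof (shifted_energy_bound sm (ltW m0) delta0 ez ez1 _ t0) as H.
  (* the equation satisfied by z *)
  move=> s s0; rewrite /acceleration.
  by field; rewrite gt_eqF.
move: H; rewrite /= (damping_int0 D) mulr0 expR0 !mul1r.
set z := expR (m * B t) * y t.
set z1 := expR (m * B t) * (y1 t + m * (b t * y t)).
move=> H.
have b0 := damping_gt0 (lexx 0); have bt0 := damping_gt0 t0.
have bb0 := damping_le (lexx 0); have bbt := damping_le t0.
have embs : forall s, 0 <= s -> 16 * (eps * m * b s) <= 1.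
  move=> s s0; apply: le_trans h1; rewrite ler_pM2l//.
  by rewrite ler_wpM2l ?damping_le// mulr_ge0 ?ltW.
have -> : 2 * m * B t = 2 * (m * B t) by ring.
rewrite expR_double.
have -> : expR (m * B t) ^+ 2 * (eps * (y1 t ^+ 2 / b t) + mu * y t ^+ 2)
   = eps * (z1 - m * b t * z) ^+ 2 / b t + mu * z ^+ 2.
  by rewrite /z /z1; ring.
set K := expR (energy_growth _) in H *.
have K0 : 0 < K by exact: expR_gt0.
have kin : eps * (z1 - m * b t * z) ^+ 2 / b t <=
    2 * (eps * z1 ^+ 2 / b t) + m / 8 * z ^+ 2.
  have -> : eps * (z1 - m * b t * z) ^+ 2 / b t = 2 * (eps * z1 ^+ 2 / b t)
     + 2 * m * (eps * m * b t) * z ^+ 2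
     - eps / b t * (z1 + m * b t * z) ^+ 2.
    by field; rewrite gt_eqF.
  have : 0 <= eps / b t * (z1 + m * b t * z) ^+ 2.
    by rewrite mulr_ge0 ?sqr_ge0// divr_ge0 ?ltW.
  have : m * (eps * m * b t) * z ^+ 2 <= m * (1 / 16) * z ^+ 2.
    apply: ler_wpM2r; first exact: sqr_ge0.
    by apply: ler_wpM2l; [exact: ltW|have := embs t t0; lra].
  lra.
have kin0 : 0 <= eps * z1 ^+ 2 / b t.
  by apply: divr_ge0; [apply: mulr_ge0 (sqr_ge0 _); exact: ltW|exact: ltW].
set L := eps * z1 ^+ 2 / b t / 2 + (mu - m) * z ^+ 2 + z ^+ 2 / 4 in H.
have left_ : eps * (z1 - m * b t * z) ^+ 2 / b t + mu * z ^+ 2 <=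
    (4 + 5 * m) * L.
  have := mulr_ge0 (mulr_ge0 (ltW m0) delta0) (sqr_ge0 z).
  have := mulr_ge0 (ltW m0) kin0; have := mulr_ge0 delta0 (sqr_ge0 z).
  have := sqr_ge0 z; have := mulr_ge0 (ltW m0) (sqr_ge0 z); rewrite /L; lra.
apply: le_trans left_ _.
rewrite /energy_const -/K -!mulrA; apply: ler_wpM2l; first lra.
apply: le_trans H _; rewrite ler_pM2l//.
have v0 : (y1 0 + m * (b 0 * y 0)) ^+ 2 <=
    2 * y1 0 ^+ 2 + 2 * (m * b 0 * y 0) ^+ 2.
  have := sqr_ge0 (y1 0 - m * (b 0 * y 0)); rewrite !expr2; lra.
have kin1 : 2 * eps * (y1 0 + m * (b 0 * y 0)) ^+ 2 / b 0 <=
   4 / b 0 * (eps * y1 0 ^+ 2) + m / 4 * y 0 ^+ 2.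
  have -> : 4 / b 0 * (eps * y1 0 ^+ 2) = 2 * eps / b 0 * (2 * y1 0 ^+ 2).
    by field; rewrite gt_eqF.
  have eb : 0 <= 2 * eps / b 0 by rewrite divr_ge0 ?mulr_ge0 ?(ltW e0)// ltW.
  have := ler_wpM2l eb v0.
  have -> : 2 * eps / b 0 * (2 * y1 0 ^+ 2 + 2 * (m * b 0 * y 0) ^+ 2) =
     2 * eps / b 0 * (2 * y1 0 ^+ 2) + 4 * m * (eps * m * b 0) * y 0 ^+ 2.
    by field; rewrite gt_eqF.
  have -> : 2 * eps / b 0 * (y1 0 + m * (b 0 * y 0)) ^+ 2
    = 2 * eps * (y1 0 + m * (b 0 * y 0)) ^+ 2 / b 0.
    by field; rewrite gt_eqF.
  have : m * (eps * m * b 0) * y 0 ^+ 2 <= m * (1 / 16) * y 0 ^+ 2.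
    apply: ler_wpM2r; first exact: sqr_ge0.
    by apply: ler_wpM2l; [exact: ltW|have := embs 0 (lexx 0); lra].
  lra.
have w0 : 2 * y 0 ^+ 2 <= 2 / m * (mu * y 0 ^+ 2).
  rewrite [leRHS]mulrA; apply: ler_wpM2r; first exact: sqr_ge0.
  by rewrite mulrAC ler_pdivlMr// ler_pM2l.
have p1 : 0 <= eps * y1 0 ^+ 2 by rewrite mulr_ge0 ?sqr_ge0// ltW.
have p2 : 0 <= mu * y 0 ^+ 2 by rewrite mulr_ge0 ?sqr_ge0//; lra.
have p3 : 0 <= 4 / b 0 * (mu * y 0 ^+ 2) by rewrite mulr_ge0// divr_ge0// ltW.
have p4 : 0 <= 2 / m * (eps * y1 0 ^+ 2) by rewrite mulr_ge0// divr_ge0// ltW.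
have p5 : 0 <= m * y 0 ^+ 2 by rewrite mulr_ge0 ?sqr_ge0//; lra.
lra.
Qed.

(** The coefficient [a] of the relaxation equations solved by
    [e^(m B) y' / b] (with [k = 1]) and [e^(m B) y'' / b^2] (with [k = 2]):
    differentiating the weights perturbs it by terms of size [eps b] only. *)
Lemma relaxation_rate (eps m k t : R) : small_eps m bet C eps -> 0 <= m ->
  0 <= k <= 2 -> 0 < t ->
  1 / 2 <= 1 - eps * m * b t + k * (eps * (b' t / b t)).
Proof.
move=> [/andP[e0 e1] h1 h2 h3] m0 /andP[k0 k2] t0.
have bt0 := damping_gt0 (ltW t0); have bbt := damping_le (ltW t0).
have [bq qC] := damping_ratio t0.
have -> : b' t / b t = b' t / b t ^+ 2 * b t by field; rewrite gt_eqF.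
set q := b' t / b t ^+ 2 in qC *; clearbody q.
have emb : eps * m * b t <= 1 / 16.
  have : eps * m * b t <= eps * m * bet by rewrite ler_wpM2l// mulr_ge0// ltW.
  by lra.
have eqb : `|eps * (q * b t)| <= 1 / 16.
  rewrite !normrM (ger0_norm (ltW e0)) (ger0_norm (ltW bt0)).
  have : `|q| * b t <= C * bet by apply: ler_pM => //; exact: ltW.
  move=> /(ler_wpM2l (ltW e0)); lra.
have := ler_norm (- (eps * (q * b t))); rewrite normrN => eqb'.
have : k * (- (eps * (q * b t))) <= 2 * (1 / 16).
  have [s|s] := lerP (- (eps * (q * b t))) 0.
    by apply: le_trans (_ : 0 <= _); [exact: mulr_ge0_le0|lra].
  by apply: ler_pM => //; [exact: ltW|lra].
lra.
Qed.

(** [s = e^(m B) y' / b] relaxes towards [- mu e^(m B) y], which the energy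
    bounds in terms of [mu] times the data. *)
Lemma mode_velocity_bound (eps m mu : R) (y y1 : R -> R) :
  small_eps m bet C eps -> 0 < m <= mu -> mode eps mu b y y1 ->
  forall t, 0 <= t ->
    expR (2 * m * B t) * (y1 t ^+ 2 / b t ^+ 2) <=
    y1 0 ^+ 2 / b 0 ^+ 2
      + 4 * (energy_const m (b 0) * (mu * (eps * y1 0 ^+ 2 + mu * y 0 ^+ 2))).
Proof.
move=> sm /andP[m0 mmu] Hm; have [ey ey1] := Hm; have [/andP[e0 e1] h1 h2 h3] := sm.
have bn0 s : 0 <= s -> b s != 0 by move=> s0; rewrite gt_eqF// damping_gt0.
have mu0 : 0 < mu by lra.
have eE := evolves_exp (evolvesZ m (damping_int D)).
have es := evolvesM (evolvesM eE ey1) (evolvesV bn0 (damping_evolves D)).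
pose a s := 1 - eps * m * b s + 1 * (eps * (b' s / b s)).
pose f s := - (mu * (expR (m * B s) * y s)).
set M := energy_const m (b 0) * (mu * (eps * y1 0 ^+ 2 + mu * y 0 ^+ 2)).
have M0 : 0 <= M.
  rewrite mulr_ge0 ?energy_const_ge0// mulr_ge0 ?(ltW mu0)//.
  by rewrite addr_ge0// mulr_ge0 ?sqr_ge0// ltW.
have En s : 0 <= s -> f s ^+ 2 <= M.
  move=> s0; have bs0 := damping_gt0 s0.
  rewrite /M mulrCA /f sqrrN exprMn expr2 -mulrA.
  apply: ler_wpM2l; first exact: ltW.
  apply: le_trans (mode_energy_bound sm _ Hm s0); last by rewrite m0.
  have -> : 2 * m * B s = 2 * (m * B s) by ring.
  rewrite expR_double exprMn mulrCA mulrDr lerDr.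
  rewrite mulr_ge0 ?sqr_ge0// mulr_ge0 ?(ltW e0)// divr_ge0 ?sqr_ge0//.
  exact: ltW.
move=> t t0.
have := @relaxation_bound _ eps M _ _ a f e0 M0 es _ t t0.
rewrite /= (damping_int0 D) mulr0 expR0 (mul1r (y1 0)) -!exprVn -!exprMn.
have -> : 2 * m * B t = 2 * (m * B t) by ring.
rewrite expR_double -exprMn mulrA; apply.
move=> s s0; split; [|by apply: relaxation_rate sm _ _ s0; lra|exact/En/ltW].
rewrite /a /f /acceleration; field.
by rewrite !gt_eqF// damping_gt0// ltW.
Qed.

(** [th] is the second derivative of the corrector. It solves [eps th' + th = 0]
    and starts at [y''(0)], so that [s = e^(m B) (y'' - th) / b^2] starts at 0
    and relaxes towards [- mu e^(m B) (b' y / b^2 + y' / b)]. *)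
Lemma mode_acceleration_bound (eps m mu : R) (y y1 th th1 : R -> R) :
  small_eps m bet C eps -> 0 < m <= mu -> mode eps mu b y y1 ->
  evolves th th1 -> (forall t, 0 < t -> eps * th1 t + th t = 0) ->
  th 0 = acceleration eps mu b y y1 0 ->
  forall t, 0 <= t ->
    expR (2 * m * B t) *
      ((acceleration eps mu b y y1 t - th t) ^+ 2 / b t ^+ 4) <=
    8 * (C ^+ 2 * (energy_const m (b 0) * (mu * (eps * y1 0 ^+ 2 + mu * y 0 ^+ 2)))
     + mu ^+ 2 * (y1 0 ^+ 2 / b 0 ^+ 2
      + 4 * (energy_const m (b 0) * (mu * (eps * y1 0 ^+ 2 + mu * y 0 ^+ 2))))).
Proof.
move=> sm mmu' Hm eth thE th0; have /andP[m0 mmu] := mmu'.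
have [ey ey1] := Hm; have [/andP[e0 e1] h1 h2 h3] := sm.
have bn0 s : 0 <= s -> b s != 0 by move=> s0; rewrite gt_eqF// damping_gt0.
have mu0 : 0 < mu by lra.
have eE := evolves_exp (evolvesZ m (damping_int D)).
have ebb := damping_evolves D.
have eacc : evolves (acceleration eps mu b y y1)
    (fun t => - (acceleration eps mu b y y1 t + mu * (b' t * y t + b t * y1 t)) / eps).
  have e := evolvesZ (- eps^-1) (evolvesD ey1 (evolvesZ mu (evolvesM ebb ey))).
  have -> : acceleration eps mu b y y1 =
      (fun t => - eps^-1 * (y1 t + mu * (b t * y t))).
    by apply/funext => s; rewrite /acceleration; field; rewrite gt_eqF.
  by apply: evolves_eq e _ => s s0; rewrite /acceleration; field; rewrite gt_eqF.
have es := evolvesM (evolvesM eE (evolvesB eacc eth))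
  (evolvesM (evolvesV bn0 ebb) (evolvesV bn0 ebb)).
pose a s := 1 - eps * m * b s + 2 * (eps * (b' s / b s)).
pose f s := - (mu * (expR (m * B s) * (b' s / b s ^+ 2 * y s + y1 s / b s))).
set W := energy_const m (b 0) * (mu * (eps * y1 0 ^+ 2 + mu * y 0 ^+ 2)).
set M := 2 * (C ^+ 2 * W + mu ^+ 2 * (y1 0 ^+ 2 / b 0 ^+ 2 + 4 * W)).
have En s : 0 <= s -> mu ^+ 2 * (expR (m * B s) * y s) ^+ 2 <= W.
  move=> s0; have bs0 := damping_gt0 s0.
  rewrite /W [leRHS]mulrCA [mu ^+ 2]expr2 -[leLHS]mulrA.
  apply: ler_wpM2l; first exact: ltW.
  apply: le_trans (mode_energy_bound sm _ Hm s0); last by rewrite m0.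
  have -> : 2 * m * B s = 2 * (m * B s) by ring.
  rewrite expR_double exprMn mulrCA mulrDr lerDr.
  rewrite mulr_ge0 ?sqr_ge0// mulr_ge0 ?(ltW e0)// divr_ge0 ?sqr_ge0//.
  exact: ltW.
have W0 : 0 <= W by apply: le_trans (En 0 (lexx _)); rewrite mulr_ge0 ?sqr_ge0.
have M0 : 0 <= M.
  have V0 : 0 <= y1 0 ^+ 2 / b 0 ^+ 2 by apply: divr_ge0; exact: sqr_ge0.
  apply: mulr_ge0 => //; apply: addr_ge0; apply: mulr_ge0 (sqr_ge0 _) _ => //.
  by lra.
have Vn s : 0 <= s -> (expR (m * B s) * (y1 s / b s)) ^+ 2 <=
    y1 0 ^+ 2 / b 0 ^+ 2 + 4 * W.
  move=> s0; apply: le_trans (mode_velocity_bound sm mmu' Hm s0).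
  have -> : 2 * m * B s = 2 * (m * B s) by ring.
  by rewrite expR_double exprMn expr_div_n.
have fM s : 0 < s -> f s ^+ 2 <= M.
  move=> s0; have [_ qC] := damping_ratio s0; rewrite /f.
  set q := b' s / b s ^+ 2 in qC *.
  have q2 : q ^+ 2 <= C ^+ 2.
    rewrite -[q ^+ 2]ger0_norm ?sqr_ge0// normrX.
    by rewrite lerXn2r ?nnegrE ?normr_ge0 ?(damping_C D).
  rewrite sqrrN mulrDr exprMn.
  apply: le_trans (ler_wpM2l (sqr_ge0 _) (sqr_add_le _ _)) _.
  rewrite [leLHS](_ : _ = 2 * (q ^+ 2 * (mu ^+ 2 * (expR (m * B s) * y s) ^+ 2) +
    mu ^+ 2 * (expR (m * B s) * (y1 s / b s)) ^+ 2)); last by ring.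
  rewrite ler_pM2l//; apply: lerD.
    apply: ler_pM; [exact: sqr_ge0| |exact: q2|exact/En/ltW].
    by apply: mulr_ge0; exact: sqr_ge0.
  by apply: ler_wpM2l; [exact: sqr_ge0|exact/Vn/ltW].
move=> t t0.
have := @relaxation_bound _ eps M _ _ a f e0 M0 es _ t t0.
rewrite /= th0 subrr mulr0 mul0r expr0n /= add0r => H.
have -> : expR (2 * m * B t) *
   ((acceleration eps mu b y y1 t - th t) ^+ 2 / b t ^+ 4) =
  (expR (m * B t) * (acceleration eps mu b y y1 t - th t)
           * ((b t)^-1 / b t)) ^+ 2.
  have -> : 2 * m * B t = 2 * (m * B t) by ring.
  by rewrite expR_double; field; apply: bn0.
have -> : 8 * (C ^+ 2 * W + mu ^+ 2 * (y1 0 ^+ 2 / b 0 ^+ 2 + 4 * W)) = 4 * M.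
  by rewrite /M; ring.
apply: H => s s0; split; [|by apply: relaxation_rate sm _ _ s0; lra|exact: fM].
have -> : th1 s = - th s / eps.
  have /eqP := thE s s0; rewrite addr_eq0 => /eqP <-.
  by field; rewrite gt_eqF.
rewrite /a /f /acceleration; field.
by rewrite !gt_eqF// damping_gt0// ltW.
Qed.

(** The corrector decays like [e^(- t / eps)], faster than
    [b^2 e^(- m B)]; here this is seen as relaxation towards 0. *)
Lemma corrector_bound (eps m : R) (th th1 : R -> R) :
  small_eps m bet C eps -> 0 <= m ->
  evolves th th1 -> (forall t, 0 < t -> eps * th1 t + th t = 0) ->
  forall t, 0 <= t ->
    expR (2 * m * B t) * (th t ^+ 2 / b t ^+ 4) <= th 0 ^+ 2 / b 0 ^+ 4.
Proof.
move=> sm m0 eth thE; have [/andP[e0 e1] h1 h2 h3] := sm.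
have bn0 s : 0 <= s -> b s != 0 by move=> s0; rewrite gt_eqF// damping_gt0.
have eE := evolves_exp (evolvesZ m (damping_int D)).
have ebb := damping_evolves D.
have es := evolvesM (evolvesM eE eth)
  (evolvesM (evolvesV bn0 ebb) (evolvesV bn0 ebb)).
pose a s := 1 - eps * m * b s + 2 * (eps * (b' s / b s)).
move=> t t0.
have := @relaxation_bound _ eps 0 _ _ a (fun=> 0) e0 (lexx 0) es _ t t0.
rewrite /= mulr0 addr0 (damping_int0 D) mulr0 expR0 (mul1r (th 0)).
have sq s : expR (2 * m * B s) * (th s ^+ 2 / b s ^+ 4) =
  (expR (m * B s) * th s * ((b s)^-1 / b s)) ^+ 2.
  have -> : 2 * m * B s = 2 * (m * B s) by ring.
  by rewrite expR_double -invfM -expr2 exprMn -exprVn -exprM exprVn exprMn mulrA.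
rewrite sq.
have -> : th 0 ^+ 2 / b 0 ^+ 4 = (th 0 * ((b 0)^-1 / b 0)) ^+ 2.
  by field; exact: bn0.
apply=> s s0; split; [|by apply: relaxation_rate sm _ _ s0; lra|by rewrite expr0n].
have -> : th1 s = - th s / eps.
  have /eqP := thE s s0; rewrite addr_eq0 => /eqP <-.
  by field; rewrite gt_eqF.
rewrite /a; field.
by rewrite !gt_eqF// damping_gt0// ltW.
Qed.

(** As [b >= kap / (1 + t)], the logarithmic derivative [p b] of [e^(p B)] is at
    least that of [(1 + t)^2]. *)
Lemma expB_growth (p : R) : 2 <= p * kap ->
  forall t, 0 <= t -> (1 + t) ^+ 2 <= expR (p * B t).
Proof.
move=> pk t t0.
have e1 := evolvesD (evolves_cst 1) (@evolves_id R).
unshelve epose proof (evolves_gronwall (evolvesM e1 e1)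
  (evolvesZ p (damping_int D)) _ t0) as H; last first.
  by move: H; rewrite /= (damping_int0 D) mulr0 subr0 addr0 !mulr1 expr2.
move=> s s0 /=; rewrite add0r mul1r mulr1.
have b0 := damping_lower D (ltW s0).
have p0 : 0 <= p by have := damping_kap D; nra.
have : p * (kap / (1 + s)) <= p * b s by rewrite ler_wpM2l.
rewrite mulrA ler_pdivrMr; last by lra.
by move=> h; nra.
Qed.

(** At the faster rate [e^(- (m + p) B)] the weight [b^(-2)] is for free by
    [expB_growth], and the triangle inequality in
    [eps y'' = - (y' + b mu y)] suffices. *)
Lemma mode_acceleration_rough (eps m p mu : R) (y y1 : R -> R) :
  2 <= p * kap -> small_eps (m + p) bet C eps -> 0 < m -> m + p <= mu ->
  mode eps mu b y y1 ->
  forall t, 0 <= t ->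
    expR (2 * m * B t) * (acceleration eps mu b y y1 t ^+ 2 / b t ^+ 4) <=
    2 / (eps ^+ 2 * kap ^+ 4) * ((bet / eps + bet ^+ 2 * mu) *
      (energy_const (m + p) (b 0) * (eps * y1 0 ^+ 2 + mu * y 0 ^+ 2))).
Proof.
move=> pk sm m0 mmu Hm t t0; have [/andP[e0 e1] h1 h2 h3] := sm.
have kap0 := damping_kap D; have bet0 := damping_bet D.
have p0 : 0 < p by nra.
have mu0 : 0 < mu by lra.
have bt0 := damping_gt0 t0; have bbt := damping_le t0.
have mp : 0 < m + p <= mu by rewrite mmu andbT; lra.
have := mode_energy_bound sm mp Hm t0.
set W := energy_const _ _ * _ => En.
have -> : expR (2 * m * B t) * (acceleration eps mu b y y1 t ^+ 2 / b t ^+ 4)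
  = expR (2 * m * B t) / b t ^+ 4 / eps ^+ 2 * (y1 t + b t * mu * y t) ^+ 2.
  by rewrite /acceleration; field; rewrite !gt_eqF.
have w : expR (2 * m * B t) / b t ^+ 4 <= expR (2 * (m + p) * B t) / kap ^+ 4.
  rewrite ler_pdivrMr ?exprn_gt0// [leRHS]mulrAC ler_pdivlMr ?exprn_gt0//.
  have -> : 2 * (m + p) * B t = 2 * m * B t + 2 * (p * B t) by ring.
  rewrite expRD -[leRHS]mulrA ler_pM2l ?expR_gt0// expR_double.
  have /(_ t t0) := expB_growth pk; have := damping_lower D t0.
  rewrite ler_pdivrMr; last by lra.
  move=> k1 k2.
  apply: le_trans (_ : ((1 + t) ^+ 2) ^+ 2 * b t ^+ 4 <= _).
    by rewrite -exprM -exprMn lerXn2r ?nnegrE ?(ltW kap0) ?mulr_ge0 ?(ltW bt0)//;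
      [lra|rewrite mulrC].
  by rewrite ler_pM2r ?exprn_gt0// lerXn2r ?nnegrE ?expR_ge0// sqr_ge0.
set E := expR (2 * (m + p) * B t) in En w.
have E0 : 0 < E by exact: expR_gt0.
apply: le_trans (_ : E / kap ^+ 4 / eps ^+ 2 *
   (2 * y1 t ^+ 2 + 2 * (b t * mu * y t) ^+ 2) <= _).
  apply: ler_pM; rewrite ?sqr_ge0 ?sqr_add_le//.
    by rewrite !divr_ge0 ?expR_ge0 ?exprn_ge0// ltW.
  by rewrite ler_pM2r// invr_gt0 exprn_gt0.
have K1 : E * (eps * (y1 t ^+ 2 / b t)) <= W.
  apply: le_trans En; rewrite mulrDr lerDl.
  by apply: mulr_ge0; [exact: ltW|apply: mulr_ge0 (sqr_ge0 _); exact: ltW].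
have K2 : E * (mu * y t ^+ 2) <= W.
  apply: le_trans En; rewrite mulrDr lerDr.
  apply: mulr_ge0; first exact: ltW.
  by rewrite mulr_ge0 ?(ltW e0)// divr_ge0 ?sqr_ge0// ltW.
have W0 : 0 <= W.
  by apply: le_trans K2; nonneg.
have K3 : E * y1 t ^+ 2 <= bet / eps * W.
  have -> : E * y1 t ^+ 2 = b t / eps * (E * (eps * (y1 t ^+ 2 / b t))).
    by field; rewrite !gt_eqF.
  apply: ler_pM => //; [by nonneg|by nonneg|].
  by rewrite ler_pM2r ?invr_gt0.
have K4 : E * (b t * mu * y t) ^+ 2 <= bet ^+ 2 * mu * W.
  have -> : E * (b t * mu * y t) ^+ 2 = b t ^+ 2 * mu * (E * (mu * y t ^+ 2)).
    by ring.
  apply: ler_pM => //; [by nonneg|by nonneg|].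
  by rewrite ler_pM2r// lerXn2r// nnegrE; apply: ltW.
rewrite [leLHS](_ : _ = 2 / (eps ^+ 2 * kap ^+ 4) *
   (E * y1 t ^+ 2 + E * (b t * mu * y t) ^+ 2)); last first.
  by field; rewrite !gt_eqF.
apply: ler_wpM2l; first by nonneg.
by rewrite mulrDl lerD.
Qed.

Lemma small_epsS (m m' eps : R) : m <= m' -> small_eps m' bet C eps ->
  small_eps m bet C eps.
Proof.
move=> mm [/andP[e0 e1] h1 h2 h3]; split=> //; first by rewrite e0.
apply: le_trans h1; rewrite ler_pM2l//.
by apply: ler_wpM2r; [exact/ltW/(damping_bet D)|rewrite ler_pM2l].
Qed.

(** Below the threshold [m + p] powers of [mu] are constants and
    [mode_acceleration_bound] applies; above it, the two accelerations are
    estimated separately by [mode_acceleration_rough] and [corrector_bound]. The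
    right-hand side is summable over the modes as soon as the data are in
    [D(A) x D(A^(1/2))]. *)
Lemma mode_acceleration_data_bound (eps m p : R) :
  2 <= p * kap -> 0 < m -> small_eps (m + p) bet C eps ->
  exists Q : R, forall (mu : R) (y y1 th th1 : R -> R),
    m <= mu -> mode eps mu b y y1 ->
    evolves th th1 -> (forall t, 0 < t -> eps * th1 t + th t = 0) ->
    th 0 = acceleration eps mu b y y1 0 ->
    forall t, 0 <= t ->
      expR (2 * m * B t) *
        ((acceleration eps mu b y y1 t - th t) ^+ 2 / b t ^+ 4) <=
      Q * ((1 + mu) * y1 0 ^+ 2 + (mu + mu ^+ 2) * y 0 ^+ 2).
Proof.
move=> pk m0 sm'; have [/andP[e0 e1] _ _ _] := sm'.
have kap0 := damping_kap D; have bet0 := damping_bet D.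
have p0 : 0 < p by nra.
have sm : small_eps m bet C eps by apply: small_epsS sm'; lra.
have b00 := damping_gt0 (lexx 0).
set k := energy_const m (b 0); set k' := energy_const (m + p) (b 0).
have k0 : 0 <= k by exact: energy_const_ge0.
have k'0 : 0 <= k' by apply: energy_const_ge0; lra.
pose Q1 := 8 * (C ^+ 2 * k + (m + p) ^+ 2 * (1 / b 0 ^+ 2 + 4 * k)).
pose Q2 := 2 * (2 / (eps ^+ 2 * kap ^+ 4) * (bet / eps + bet ^+ 2) * k').
pose Q3 := 4 * (1 + b 0 ^+ 2) / eps ^+ 2 / b 0 ^+ 4.
have Q10 : 0 <= Q1 by rewrite /Q1; nonneg; lra.
have Q20 : 0 <= Q2 by rewrite /Q2; nonneg.
have Q30 : 0 <= Q3 by rewrite /Q3; nonneg.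
exists (Q1 + Q2 + Q3) => mu y y1 th th1 mmu Hm eth thE th0 t t0.
have mu0 : 0 < mu by lra.
set X := (1 + mu) * y1 0 ^+ 2 + (mu + mu ^+ 2) * y 0 ^+ 2.
have [a0 a1] : 0 <= y1 0 ^+ 2 /\ 0 <= mu * y1 0 ^+ 2 by split; nonneg.
have [c0 c1] : 0 <= mu * y 0 ^+ 2 /\ 0 <= mu ^+ 2 * y 0 ^+ 2 by split; nonneg.
have X0 : 0 <= X by rewrite /X; lra.
set E0 := eps * y1 0 ^+ 2 + mu * y 0 ^+ 2.
have ea : eps * y1 0 ^+ 2 <= y1 0 ^+ 2 by rewrite -[leRHS]mul1r; apply: ler_wpM2r.
have E0X : E0 <= X by rewrite /X /E0; lra.
have eb : eps * (mu * y1 0 ^+ 2) <= mu * y1 0 ^+ 2.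
  by rewrite -[leRHS]mul1r; apply: ler_wpM2r.
have E1X : mu * E0 <= X by rewrite /X /E0; lra.
have E00 : 0 <= E0 by rewrite /E0; nonneg.
have [lo|hi] := ltP mu (m + p).
  apply: le_trans (_ : Q1 * X <= _); last by rewrite ler_wpM2r//; lra.
  apply: le_trans (mode_acceleration_bound sm _ Hm eth thE th0 t0) _.
    by rewrite m0.
  rewrite -/k -/E0 /Q1 -[leRHS]mulrA ler_pM2l// [leRHS]mulrDl; apply: lerD.
    by rewrite -[leRHS]mulrA; apply: ler_wpM2l; [nonneg|apply: ler_wpM2l].
  rewrite -[leRHS]mulrA; apply: ler_pM; [by nonneg| | |].
  - by nonneg.
  - by rewrite lerXn2r ?nnegrE; lra.
  rewrite [leRHS]mulrDl; apply: lerD.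
    by rewrite [leRHS]mulrAC mul1r ler_pM2r ?invr_gt0 ?exprn_gt0// /X; lra.
  by rewrite -[leRHS]mulrA ler_pM2l//; apply: ler_wpM2l.
apply: le_trans (_ : (Q2 + Q3) * X <= _); last by rewrite ler_wpM2r//; lra.
have bt0 := damping_gt0 t0.
have ex0 := expR_gt0 (2 * m * B t).
have A1 := mode_acceleration_rough pk sm' m0 hi Hm t0.
have A2 := corrector_bound sm (ltW m0) eth thE t0.
apply: le_trans (_ : 2 * (expR (2 * m * B t) *
   (acceleration eps mu b y y1 t ^+ 2 / b t ^+ 4)) +
   2 * (expR (2 * m * B t) * (th t ^+ 2 / b t ^+ 4)) <= _).
  rewrite [leRHS](_ : _ = expR (2 * m * B t) *
     ((2 * acceleration eps mu b y y1 t ^+ 2 + 2 * th t ^+ 2) / b t ^+ 4)).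
    2: by field; rewrite gt_eqF.
  rewrite ler_pM2l// ler_pM2r ?invr_gt0 ?exprn_gt0//.
  by have := sqr_add_le (acceleration eps mu b y y1 t) (- th t); rewrite sqrrN.
rewrite [leRHS]mulrDl; apply: lerD.
  rewrite /Q2 -[leRHS]mulrA ler_pM2l//; apply: le_trans A1 _.
  rewrite -/k' -/E0; set c := 2 / _.
  have c0' : 0 <= c by rewrite /c; nonneg.
  rewrite [leLHS](_ : _ =
    c * (bet / eps * (k' * E0) + bet ^+ 2 * (k' * (mu * E0)))); last by ring.
  rewrite [leRHS](_ : _ =
    c * (bet / eps * (k' * X) + bet ^+ 2 * (k' * X))); last by ring.
  apply: ler_wpM2l => //; apply: lerD.
    by apply: ler_wpM2l; [nonneg|apply: ler_wpM2l].
  by apply: ler_wpM2l; [nonneg|apply: ler_wpM2l].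
apply: le_trans (_ : 2 * (th 0 ^+ 2 / b 0 ^+ 4) <= _); first by rewrite ler_pM2l.
have th0X : th 0 ^+ 2 <= 2 * (1 + b 0 ^+ 2) / eps ^+ 2 * X.
  rewrite th0 /acceleration.
  have -> : (- (y1 0 + b 0 * mu * y 0) / eps) ^+ 2 =
     (y1 0 + b 0 * mu * y 0) ^+ 2 / eps ^+ 2 by field; rewrite gt_eqF.
  rewrite [leRHS]mulrAC ler_pM2r ?invr_gt0 ?exprn_gt0//.
  apply: le_trans (sqr_add_le _ _) _.
  have b2 : 0 <= b 0 ^+ 2 by nonneg.
  have -> : 2 * y1 0 ^+ 2 + 2 * (b 0 * mu * y 0) ^+ 2 =
     2 * (y1 0 ^+ 2 + b 0 ^+ 2 * (mu ^+ 2 * y 0 ^+ 2)) by ring.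
  have h : b 0 ^+ 2 * (mu ^+ 2 * y 0 ^+ 2) <= b 0 ^+ 2 * X.
    by apply: ler_wpM2l => //; rewrite /X; lra.
  have : y1 0 ^+ 2 <= X by rewrite /X; lra.
  by lra.
rewrite /Q3 (_ : _ * X = 2 * (2 * (1 + b 0 ^+ 2) / eps ^+ 2 * X / b 0 ^+ 4)).
  by rewrite ler_pM2l// ler_pM2r// invr_gt0 exprn_gt0.
by field; rewrite !gt_eqF.
Qed.

End Modes.

(** * Derivatives along the half-line *)

Section HalfLineDerivative.
Context (R : realType).
Implicit Types (H : normedModType R) (t : R).

(** The right neighbourhoods of a point of the half-line are proper, which gives
    the uniqueness of derivatives along it, at 0 included. *)
Lemma half_line_right t (P : set R) : 0 <= t ->
  within (@half_line R) t^' P -> t^'+ P.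
Proof.
move=> t0 h; rewrite /at_right /within /=.
apply: (filterS _ (h : nbhs t (fun s => s != t -> half_line s -> P s))).
move=> s {}h ts; apply: h; first by rewrite gt_eqF.
by rewrite /half_line /= in_itv /= andbT ltW// (le_lt_trans t0 ts).
Qed.

Lemma hderivE H (f : R -> H) t (l : H) : 0 <= t ->
  quotient f t @ within (@half_line R) t^' --> l -> hderiv f t = l.
Proof.
move=> t0 fl.
have fl' : quotient f t @ within (@half_line R) t^' --> hderiv f t.
  by apply: (cvgP l).
have r (l' : H) : quotient f t @ within (@half_line R) t^' --> l' ->
    quotient f t @ t^'+ --> l'.
  by move=> h P /h; exact: half_line_right.
exact: (norm_cvg_unique (r _ fl') (r _ fl)).
Qed.

Lemma hderivable_of_cvg H (f : R -> H) t (l : H) :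
  quotient f t @ within (@half_line R) t^' --> l -> hderivable f t.
Proof. exact: cvgP. Qed.

Lemma cvg_quotient_ext H (f g : R -> H) t (l : H) : 0 <= t ->
  (forall s, 0 <= s -> f s = g s) ->
  quotient f t @ within (@half_line R) t^' --> l ->
  quotient g t @ within (@half_line R) t^' --> l.
Proof.
move=> t0 fg; apply: cvg_trans; apply: near_eq_cvg.
have h : forall s, half_line s -> quotient f t s = quotient g t s.
  move=> s; rewrite /half_line /= in_itv /= andbT => s0.
  by rewrite /quotient !fg.
rewrite /within /=; apply: (@filterS _ t^' _ setT); last exact: filterT.
by move=> s _ hs /=; rewrite h.
Qed.

Lemma hderiv_ext H (f g : R -> H) t : 0 <= t ->
  (forall s, 0 <= s -> f s = g s) -> hderivable f t ->
  hderivable g t /\ hderiv g t = hderiv f t.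
Proof.
move=> t0 fg df; have c := cvg_quotient_ext t0 fg df.
by split; [exact: hderivable_of_cvg c|exact: hderivE c].
Qed.

Lemma hderiv_linear (H H' : normedModType R) (L : H -> H') (f : R -> H) t :
  (forall x y, L (x - y) = L x - L y) -> (forall a x, L (a *: x) = a *: L x) ->
  continuous L -> 0 <= t -> hderivable f t ->
  hderivable (L \o f) t /\ hderiv (L \o f) t = L (hderiv f t).
Proof.
move=> LB LZ cL t0 df.
have c : quotient (L \o f) t @ within (@half_line R) t^' --> L (hderiv f t).
  have -> : quotient (L \o f) t = L \o quotient f t.
    by apply/funext => s; rewrite /quotient /= LZ LB.
  by apply: continuous_cvg df; exact: cL.
by split; [exact: hderivable_of_cvg c|exact: hderivE c].
Qed.

Lemma C0_cvg H (f : R -> H) t : is_C0 f -> 0 <= t ->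
  f @ within (@half_line R) (nbhs t) --> f t.
Proof.
move=> /subspace_continuousP cf t0; apply: cf.
by rewrite /half_line /= in_itv /= andbT.
Qed.

Lemma hderivable_is_derive (f : R -> R) t : 0 < t -> hderivable f t ->
  is_derive t (1 : R) f (hderiv f t).
Proof.
move=> t0 df; set l := hderiv f t.
have c : (fun h => h^-1 *: ((f \o shift t) (h *: (1 : R)) - f t)) @ 0^' --> l.
  apply/cvgrPdist_lt => d d0.
  have /cvgrPdist_lt/(_ d d0) h := (df : _ --> l).
  have {}h : nbhs t (fun s => s != t -> half_line s -> `|l - quotient f t s| < d).
    exact: h.
  have h0 : nbhs t (fun s => 0 < s) by exact: lt_nbhsr.
  have : nbhs t (fun s => s != t -> `|l - quotient f t s| < d).
    apply: filterS2 h h0 => s h s0 st; apply: h => //.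
    by rewrite /half_line /= in_itv /= andbT ltW.
  move=> /nbhs0P; apply: filterS => r hr r0.
  have := hr _; rewrite /quotient /= /shift /=.
  rewrite (addrC t) addrK /GRing.scale /= mulr1; apply.
  by rewrite -subr_eq0 addrK.
apply: DeriveDef; first by apply/cvg_ex; exists l.
exact: cvg_lim c.
Qed.

Lemma evolves_hderiv (f f' : R -> R) :
  (forall t, 0 <= t -> f @ within (@half_line R) (nbhs t) --> f t) ->
  (forall t, 0 <= t -> hderivable f t) ->
  (forall t, 0 < t -> hderiv f t = f' t) -> evolves f f'.
Proof.
move=> cf df E; split=> t t0; last exact: cf.
by rewrite -E//; apply: hderivable_is_derive => //; exact/df/ltW.
Qed.

End HalfLineDerivative.

(** * The inner product and expansions in an orthonormal basis *)

Section Hilbert.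
Context (R : realType) (H : completeNormedModType R) (ip : {dot H for idfun}).
Context (Hip : norm_from_ip ip).

Lemma ipC u v : ip u v = ip v u.
Proof. by rewrite hermC expr0 mul1r. Qed.

Lemma ipDl u v w : ip (u + v) w = ip u w + ip v w.
Proof. by rewrite linearDl. Qed.

Lemma ipBl u v w : ip (u - v) w = ip u w - ip v w.
Proof. by rewrite linearBl. Qed.

Lemma ipZl a u w : ip (a *: u) w = a * ip u w.
Proof. by rewrite linearZl_LR. Qed.

Lemma ip_suml (I : Type) (r : seq I) (P : pred I) (F : I -> H) w :
  ip (\sum_(i <- r | P i) F i) w = \sum_(i <- r | P i) ip (F i) w.
Proof. by rewrite linear_sumlz. Qed.

Lemma ipDr u v w : ip w (u + v) = ip w u + ip w v.
Proof. by rewrite ![ip w _]ipC ipDl. Qed.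

Lemma ipZr a u w : ip w (a *: u) = a * ip w u.
Proof. by rewrite ![ip w _]ipC ipZl. Qed.

Lemma ip_sumr (I : Type) (r : seq I) (P : pred I) (F : I -> H) w :
  ip w (\sum_(i <- r | P i) F i) = \sum_(i <- r | P i) ip w (F i).
Proof. by rewrite ipC ip_suml; apply: eq_bigr => i _; rewrite ipC. Qed.

(** Polarization reduces the continuity of the inner product to that of the
    norm. *)
Lemma ip_polar u v : ip u v = (`|u + v| ^+ 2 - `|u - v| ^+ 2) / 4.
Proof.
rewrite !Hip ipBl ipDl ipDr -scaleN1r !ipDr !ipZr [ip v u]ipC.
by field.
Qed.

Lemma cvg_ip (T : Type) (F : set_system T) (FF : Filter F) (f g : T -> H) u v :
  f @ F --> u -> g @ F --> v -> (fun x => ip (f x) (g x)) @ F --> ip u v.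
Proof.
move=> fu gv; rewrite ip_polar.
under eq_fun do rewrite ip_polar.
have sq (h : T -> H) a : h @ F --> a ->
    (fun x => `|h x| ^+ 2) @ F --> `|a| ^+ 2.
  by move=> ha; exact: cvgM (cvg_norm ha) (cvg_norm ha).
apply: cvgM; last exact: cvg_cst.
by apply: cvgB; apply: sq; [exact: cvgD|exact: cvgB].
Qed.

Lemma cauchy_schwarz u v : `|ip u v| <= `|u| * `|v|.
Proof.
have [->|u0] := eqVneq u 0.
  by rewrite linear0l !normr0 mul0r.
have [->|v0] := eqVneq v 0.
  by rewrite ipC linear0l !normr0 mulr0.
have key (s : R) : s ^+ 2 = 1 -> 0 <= `|u| * `|v| + s * ip u v.
  move=> s1; rewrite -(@pmulr_rge0 _ (2 * (`|u| * `|v|))); last first.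
    by rewrite !mulr_gt0// normr_gt0.
  have : 0 <= `| `|v| *: u + (s * `|u|) *: v| ^+ 2 by exact: sqr_ge0.
  rewrite Hip ipDl !ipDr !ipZl !ipZr [ip v u]ipC -!Hip.
  have -> : s * `|u| * (s * `|u| * `|v| ^+ 2) = s ^+ 2 * `|u| ^+ 2 * `|v| ^+ 2.
    by ring.
  by rewrite s1 => h; apply: le_trans h _; rewrite le_eqVlt; apply/orP; left;
    apply/eqP; ring.
have k1 := key 1 (expr1n _ _).
have k2 : 0 <= `|u| * `|v| + (-1) * ip u v by apply: key; rewrite sqrrN expr1n.
by rewrite ler_norml; apply/andP; split; lra.
Qed.

Context (K : pred nat) (e : nat -> H).
Context (He : orthonormal_basis ip K e).

Definition expansion (c : nat -> R) (n : nat) : H :=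
  \sum_(0 <= k < n | K k) c k *: e k.

Definition bounded_sums (c : nat -> R) (g : R) : Prop :=
  forall n, \sum_(0 <= k < n | K k) c k <= g.

Lemma big_nat_recr_cond (V : nmodType) (F : nat -> V) n :
  \sum_(0 <= k < n.+1 | K k) F k =
  \sum_(0 <= k < n | K k) F k + (if K n then F n else 0).
Proof. by rewrite big_mkcond big_nat_recr//= -big_mkcond. Qed.

Lemma ip_expansion c n j : K j -> ip (expansion c n) (e j) =
  if (j < n)%N then c j else 0.
Proof.
move=> Kj; have [orth _] := He; rewrite /expansion.
elim: n => [|n IH]; first by rewrite big_geq// linear0l.
rewrite big_nat_recr_cond ipDl IH [(j < n.+1)%N]ltnS [(j <= n)%N]leq_eqVlt.
have -> : ip (if K n then c n *: e n else 0) (e j) = if j == n then c j else 0.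
  have [<-|jn] := eqVneq j n; first by rewrite Kj ipZl orth// eqxx mulr1.
  case: ifP => Kn; last by rewrite linear0l.
  by rewrite ipZl orth// eq_sym (negbTE jn) mulr0.
have [->|jn] := eqVneq j n; first by rewrite ltnn add0r.
by rewrite addr0.
Qed.

Lemma sqr_norm_sum c (r : seq nat) : uniq r ->
  `|\sum_(k <- r | K k) c k *: e k| ^+ 2 = \sum_(k <- r | K k) c k ^+ 2.
Proof.
move=> ur; have [orth _] := He; rewrite Hip ip_suml.
rewrite big_seq_cond [RHS]big_seq_cond; apply: eq_bigr => j /andP[jr Kj].
rewrite ipZl ip_sumr big_mkcond (bigD1_seq j)//= Kj.
rewrite ipZr orth// eqxx mulr1 big1 ?addr0 ?expr2// => k kj.
case: ifP => // Kk.
by rewrite ipZr orth// eq_sym (negbTE kj) mulr0.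
Qed.

(** The Riesz-Fischer theorem: the squared norms of the blocks of the expansion
    are the blocks of a convergent numerical series. *)
Lemma bounded_cvg c g : bounded_sums (fun k => c k ^+ 2) g ->
  cvg (expansion c @ \oo).
Proof.
move=> cg.
pose s := fun k => if K k then c k ^+ 2 else 0.
pose v := fun k => if K k then c k *: e k else 0.
have -> : expansion c = series v.
  by apply/funext => n; rewrite /expansion /series /= big_mkcond.
have s0 k : 0 <= s k by rewrite /s; case: ifP => // _; exact: sqr_ge0.
have /cauchy_cvgP/cauchy_seriesP cs : cvg (series s @ \oo).
  apply: nondecreasing_is_cvgn.
    by apply: nondecreasing_series => n _ _.
  exists g => _ [n _ <-]; rewrite /series /= /s -big_mkcond; exact: cg.
apply/cauchy_cvgP/cauchy_seriesP => d d0.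
have := cs (d ^+ 2) (exprn_gt0 _ d0); apply: filterS => -[m n] /=.
rewrite /s /v -!big_mkcond/= -sqr_norm_sum ?iota_uniq//.
rewrite ger0_norm ?sqr_ge0// => h.
by rewrite -(@ltr_pXn2r _ 2)// ?nnegrE ?normr_ge0 ?(ltW d0).
Qed.

Lemma ip_limit c (x : H) j : K j -> expansion c @ \oo --> x -> ip x (e j) = c j.
Proof.
move=> Kj cx.
have h : (fun n => ip (expansion c n) (e j)) @ \oo --> ip x (e j).
  by apply: cvg_ip; [exact: cx|exact: cvg_cst].
apply: (cvg_unique _ h) => //.
apply: cvg_near_cst; exists j.+1 => // n /= jn.
by rewrite ip_expansion// jn.
Qed.

Definition fourier_coef (x : H) (k : nat) : R := ip x (e k).

Lemma expansion_fourier (x : H) : expansion (fourier_coef x) @ \oo --> x.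
Proof. by case: He => _; apply. Qed.

Lemma parseval_le (x : H) g : bounded_sums (fun k => fourier_coef x k ^+ 2) g ->
  `|x| ^+ 2 <= g.
Proof.
move=> xg; have cx := @expansion_fourier x.
have h : (fun n => `|expansion (fourier_coef x) n| ^+ 2) @ \oo --> `|x| ^+ 2.
  exact: cvgM (cvg_norm cx) (cvg_norm cx).
apply: (cvgr_to_le h); apply: nearW => n; rewrite sqr_norm_sum ?iota_uniq//.
Qed.

Lemma bessel (x : H) : bounded_sums (fun k => fourier_coef x k ^+ 2) (`|x| ^+ 2).
Proof.
move=> n; have [orth _] := He.
have SS : `|expansion (fourier_coef x) n| ^+ 2 = \sum_(0 <= k < n | K k) fourier_coef x k ^+ 2.
  by rewrite sqr_norm_sum ?iota_uniq.
have xS : ip x (expansion (fourier_coef x) n) = \sum_(0 <= k < n | K k) fourier_coef x k ^+ 2.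
  by rewrite ip_sumr; apply: eq_bigr => k _; rewrite ipZr expr2.
have : 0 <= `|x - expansion (fourier_coef x) n| ^+ 2 by exact: sqr_ge0.
rewrite Hip ipBl -scaleN1r !ipDr !ipZr [ip (expansion _ _) x]ipC xS -!Hip SS.
lra.
Qed.

End Hilbert.

Lemma hderiv_sqr (R : realType) (H : completeNormedModType R)
    (ip : {dot H for idfun}) (Hip : norm_from_ip ip) (v : R -> H) (t : R) :
  0 <= t -> hderivable v t ->
  hderivable (fun s => ip (v s) (v s) : R) t /\
  hderiv (fun s => ip (v s) (v s) : R) t = 2 * ip (v t) (hderiv v t).
Proof.
move=> t0 dv; set F := within (@half_line R) t^'.
have tF : (fun s : R => s) @ F --> t.
  by apply: cvg_within_filter; apply: cvg_within_filter; exact: cvg_id.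
(* Differentiability implies continuity, as v s = v t + (s - t) (quotient at s). *)
have vF : v @ F --> v t.
  have c : (fun s => v t + (s - t) *: quotient v t s) @ F -->
      v t + (t - t) *: hderiv v t.
    apply: cvgD; first exact: cvg_cst.
    by apply: cvgZ => //; apply: cvgB => //; exact: cvg_cst.
  rewrite subrr scale0r addr0 in c.
  apply: cvg_trans c; apply: near_eq_cvg.
  rewrite /F /within /=; apply: (@filterS _ (nbhs t) _ setT); last exact: filterT.
  move=> s _ st _ /=; rewrite /quotient scalerA divff ?subr_eq0//.
  by rewrite scale1r addrC subrK.
have c : quotient (fun s => ip (v s) (v s) : R) t @ F -->
    2 * ip (v t) (hderiv v t).
  have -> : quotient (fun s => ip (v s) (v s) : R) t =
      (fun s => ip (quotient v t s) (v s + v t)).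
    apply/funext => s; rewrite /quotient ipZl ipBl !ipDr [ip (v t) (v s)]ipC.
    by rewrite /GRing.scale /=; congr (_ * _); ring.
  have -> : 2 * ip (v t) (hderiv v t) = ip (hderiv v t) (v t + v t).
    by rewrite ipDr [ip (hderiv v t) _]ipC; ring.
  by apply: (cvg_ip Hip) => //; apply: cvgD => //; exact: cvg_cst.
by split; [exact: hderivable_of_cvg c|exact: hderivE c].
Qed.

(** * The primitive of the damping coefficient *)

Section Primitive.
Context (R : realType).

Lemma primitive0 (b : R -> R) : primitive b 0 = 0.
Proof. by rewrite /primitive set_itv1 Rintegral_set1. Qed.

Lemma evolves_primitive (b : R -> R) :
  (forall t : R, 0 <= t -> b @ within (@half_line R) (nbhs t) --> b t) ->
  evolves (primitive b) b.
Proof.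
move=> cb.
have sub (T : R) : `[0, T]%classic `<=` @half_line R.
  by move=> s; rewrite /half_line /= !in_itv /= => /andP[->].
have wb (T : R) : {within `[0, T], continuous b}.
  apply: (continuous_subspaceW (@sub T)); apply/subspace_continuousP => s.
  by rewrite /half_line /= in_itv /= andbT; exact: cb.
have ib (T : R) : (@lebesgue_measure R).-integrable `[0, T] (EFin \o b).
  by apply: continuous_compact_integrable; [exact: segment_compact|exact: wb].
split=> t t0.
  have ct : {for t, continuous b}.
    have h := cb t (ltW t0).
    apply/cvgrPdist_lt => d d0.
    have /cvgrPdist_lt/(_ d d0) {}h := h.
    have {}h : nbhs t (fun s => half_line s -> `|b t - b s| < d) by exact: h.
    apply: filterS2 h (lt_nbhsr t0) => s hs s0; apply: hs.
    by rewrite /half_line /= in_itv /= andbT ltW.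
  have t1 : t < t + 1 by rewrite ltrDl.
  have [d dE] := continuous_FTC1_closed t1 (ib _) t0 ct.
  by apply: DeriveDef => //; rewrite -derive1E dE.
have t01 : (0 : R) <= t + 1 by lra.
have tt1 : t < t + 1 by rewrite ltrDl.
have /subspace_continuousP := parameterized_integral_continuous t01 (ib _).
move=> /(_ t); rewrite /= in_itv /= t0 (ltW tt1) => /(_ isT) c P /c {}c.
have {}c : nbhs t (fun s => `[0, t + 1]%classic s -> P (primitive b s)) by exact: c.
rewrite /within /=; apply: filterS2 c (lt_nbhsl tt1) => s hs s1.
rewrite /half_line /= in_itv /= andbT => s0; apply: hs.
by rewrite /= in_itv /= s0 ltW.
Qed.

End Primitive.

(** * The operator, its powers and its spectral projection *)

Section Operators.
Context (R : realType) (H : completeNormedModType R) (ip : {dot H for idfun}).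
Context (Hip : norm_from_ip ip).
Context (DA : set H) (A : H -> H) (K : pred nat) (e : nat -> H) (lambda : nat -> R).
Context (HA : self_adjoint ip DA A) (He : eigenbasis ip K e lambda DA A).

Local Notation fourier := (fourier_coef ip e).
Local Notation mu k := (lambda k ^+ 2).
Let Hb : orthonormal_basis ip K e := He.1.

Lemma cvg_sum_fourier x y :
  (fun n => \sum_(0 <= k < n | K k) fourier x k * fourier y k) @ \oo --> ip x y.
Proof.
have -> : (fun n => \sum_(0 <= k < n | K k) fourier x k * fourier y k) =
   (fun n => ip (expansion K e (fourier x) n) y).
  apply/funext => n; rewrite ip_suml; apply: eq_bigr => k _.
  by rewrite ipZl [ip (e k) y]ipC.
by apply: (cvg_ip Hip); [exact: expansion_fourier|exact: cvg_cst].
Qed.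

Lemma ip_eq_fourier x y x' y' :
  (forall k, K k -> fourier x k * fourier y k = fourier x' k * fourier y' k) ->
  ip x y = ip x' y'.
Proof.
move=> h; have c := @cvg_sum_fourier x y; have c' := @cvg_sum_fourier x' y'.
apply: (cvg_unique _ c) => //.
have <- // : (fun n => \sum_(0 <= k < n | K k) fourier x' k * fourier y' k) =
  (fun n => \sum_(0 <= k < n | K k) fourier x k * fourier y k).
by apply/funext => n; apply: eq_bigr => k Kk; rewrite h.
Qed.

Lemma fourier_inj x y : (forall k, K k -> fourier x k = fourier y k) -> x = y.
Proof.
move=> h; apply/eqP; rewrite -subr_eq0 -normr_eq0 -sqrf_eq0.
rewrite Hip (@ip_eq_fourier _ _ 0 0) ?linear0l// => k Kk.
have -> : fourier (x - y) k = 0.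
  by rewrite /fourier_coef ipBl; apply/eqP; rewrite subr_eq0; apply/eqP; exact: h.
by rewrite mul0r /fourier_coef [ip 0 _]linear0l mul0r.
Qed.

Lemma fourierD x y k : fourier (x + y) k = fourier x k + fourier y k.
Proof. exact: ipDl. Qed.

Lemma fourierB x y k : fourier (x - y) k = fourier x k - fourier y k.
Proof. exact: ipBl. Qed.

Lemma fourierZ a x k : fourier (a *: x) k = a * fourier x k.
Proof. exact: ipZl. Qed.

Lemma fourier_continuous k : continuous (fun x => fourier x k).
Proof. by move=> x; apply: (cvg_ip Hip); [exact: cvg_id|exact: cvg_cst]. Qed.

Lemma bounded_sums_eq (c c' : nat -> R) (g : R) : (forall k, K k -> c k = c' k) ->
  bounded_sums K c g -> bounded_sums K c' g.
Proof. by move=> h b n; rewrite -(eq_bigr _ (fun k Kk => h k Kk)). Qed.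

Lemma fourier_pow_op (s : R) x k : K k -> pow_dom ip K e lambda s x ->
  fourier (pow_op ip K e lambda s x) k = mu k `^ s * fourier x k.
Proof.
move=> Kk xs.
exact: (ip_limit Hip Hb (c := fun k => mu k `^ s * fourier x k) Kk xs).
Qed.

Lemma pow_dom_bounded (s : R) x : pow_dom ip K e lambda s x ->
  bounded_sums K (fun k => (mu k `^ s * fourier x k) ^+ 2)
    (`|pow_op ip K e lambda s x| ^+ 2).
Proof.
move=> xs; apply: bounded_sums_eq (bessel Hip Hb _) => k Kk.
by rewrite fourier_pow_op.
Qed.

Lemma pow_op_norm_le (s : R) x g :
  bounded_sums K (fun k => (mu k `^ s * fourier x k) ^+ 2) g ->
  `|pow_op ip K e lambda s x| ^+ 2 <= g.
Proof.
move=> h; have xs : pow_dom ip K e lambda s x by exact: bounded_cvg h.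
apply: (parseval_le Hip Hb); apply: bounded_sums_eq h => k Kk.
by rewrite fourier_pow_op.
Qed.

Lemma sqr_half_pow (h k : nat) : K k -> (mu k `^ (h%:R / 2)) ^+ 2 = mu k ^+ h.
Proof.
move=> Kk; have [_ /(_ k Kk)[l0 _ _]] := He.
have m0 : 0 <= mu k by exact: sqr_ge0.
rewrite -powR_mulrn ?powR_ge0// -powRrM -(powR_mulrn h m0).
by rewrite mulfVK.
Qed.

(** By symmetry of [A], tested on the eigenvectors. *)
Lemma fourier_A x k : K k -> DA x -> fourier (A x) k = mu k * fourier x k.
Proof.
move=> Kk xD; have [_ /(_ k Kk)[_ eD Ae]] := He; have [_ _ _ sym] := HA.
by rewrite /fourier sym// Ae ipZr.
Qed.

(** Both sides have the expansion of general term [lambda_k^2 x_k y_k]. This is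
    how [A u], whose norm is controlled, enters the derivative of
    [|A^(1/2) u|^2]. *)
Lemma ip_half_power x y : DA x -> pow_dom ip K e lambda (1/2) x ->
  pow_dom ip K e lambda (1/2) y ->
  ip (pow_op ip K e lambda (1/2) x) (pow_op ip K e lambda (1/2) y) = ip (A x) y.
Proof.
move=> xD xs ys; apply: ip_eq_fourier => k Kk.
rewrite !fourier_pow_op// fourier_A//.
by have := sqr_half_pow 1 Kk; rewrite expr1 => E; rewrite -[in RHS]E; ring.
Qed.

Definition summable_modes (c : nat -> R) : Prop := exists g, bounded_sums K c g.

Lemma summable_modesD c d : summable_modes c -> summable_modes d ->
  summable_modes (fun k => c k + d k).
Proof.
move=> [g cg] [h dh]; exists (g + h) => n.
by rewrite big_split lerD.
Qed.

Lemma summable_modes_le c d : (forall k, K k -> c k <= d k) ->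
  summable_modes d -> summable_modes c.
Proof.
by move=> cd [g dg]; exists g => n; apply: le_trans (dg n); exact: ler_sum.
Qed.

(** The way mode-by-mode estimates become estimates in [H]: the weight [w]
    carries the exponential and the powers of [b] and [eps], [d] the data. *)
Lemma weighted_parseval w x Q d G : 0 < w ->
  (forall k, K k -> w * fourier x k ^+ 2 <= Q * d k) -> 0 <= Q ->
  bounded_sums K d G -> w * `|x| ^+ 2 <= Q * G.
Proof.
move=> w0 h Q0 dG.
rewrite mulrC -ler_pdivlMr//; apply: (parseval_le Hip Hb) => n.
rewrite ler_pdivlMr// mulr_suml; apply: le_trans (ler_wpM2l Q0 (dG n)).
by rewrite mulr_sumr; apply: ler_sum => k Kk; rewrite mulrC h.
Qed.

Lemma weighted_pow_op w s x Q d G : 0 < w ->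
  (forall k, K k -> w * (mu k `^ s * fourier x k) ^+ 2 <= Q * d k) -> 0 <= Q ->
  bounded_sums K d G -> w * `|pow_op ip K e lambda s x| ^+ 2 <= Q * G.
Proof.
move=> w0 h Q0 dG.
rewrite mulrC -ler_pdivlMr//; apply: pow_op_norm_le => n.
rewrite ler_pdivlMr// mulr_suml; apply: le_trans (ler_wpM2l Q0 (dG n)).
by rewrite mulr_sumr; apply: ler_sum => k Kk; rewrite mulrC h.
Qed.

Lemma summable_pow h x : pow_dom ip K e lambda (h%:R / 2) x ->
  summable_modes (fun k => mu k ^+ h * fourier x k ^+ 2).
Proof.
move=> xs; exists (`|pow_op ip K e lambda (h%:R / 2) x| ^+ 2).
apply: bounded_sums_eq (pow_dom_bounded xs) => k Kk.
by rewrite exprMn sqr_half_pow.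
Qed.

Lemma summable_dom x : DA x ->
  summable_modes (fun k => mu k ^+ 2 * fourier x k ^+ 2).
Proof.
move=> xD; exists (`|A x| ^+ 2).
apply: bounded_sums_eq (bessel Hip Hb _) => k Kk.
by rewrite fourier_A// exprMn.
Qed.

(** Interpolation: data in the domain of a power of [A] and in [H] have their
    intermediate weighted sums finite. *)
Lemma expr_le_add1 (x : R) i j : 0 <= x -> (i <= j)%N -> x ^+ i <= 1 + x ^+ j.
Proof.
move=> x0 ij; have [x1|x1] := leP x 1.
  by rewrite (le_trans (exprn_ile1 i x0 x1))// lerDl exprn_ge0.
by rewrite (le_trans (ler_weXn2l (ltW x1) ij))// lerDr.
Qed.

Lemma summable_lower i j x : (i <= j)%N ->
  summable_modes (fun k => mu k ^+ j * fourier x k ^+ 2) ->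
  summable_modes (fun k => mu k ^+ i * fourier x k ^+ 2).
Proof.
move=> ij sj.
have s0 : summable_modes (fun k => fourier x k ^+ 2).
  by exists (`|x| ^+ 2) => n; exact: (bessel Hip Hb x n).
apply: summable_modes_le (summable_modesD s0 sj) => k _.
rewrite -[X in _ <= X + _]mul1r -mulrDl ler_wpM2r ?sqr_ge0//.
by apply: expr_le_add1 => //; exact: sqr_ge0.
Qed.

Context (lam : R).
Local Notation high := (high ip K e lambda lam).

Definition high_fourier x k := if lam <= lambda k then fourier x k else 0.

Lemma high_partialE x : high_partial ip K e lambda lam x =
  expansion K e (high_fourier x).
Proof.
apply/funext => n; rewrite /high_partial /expansion big_mkcondr.
by apply: eq_bigr => k _; rewrite /high_fourier; case: ifP => // _; rewrite scale0r.
Qed.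

Lemma high_fourier_bounded x :
  bounded_sums K (fun k => high_fourier x k ^+ 2) (`|x| ^+ 2).
Proof.
move=> n; apply: le_trans (bessel Hip Hb x n); apply: ler_sum => k _.
by rewrite /high_fourier; case: ifP => // _; rewrite expr0n sqr_ge0.
Qed.

Lemma high_cvg x : high_partial ip K e lambda lam x @ \oo --> high x.
Proof.
by rewrite /Defs.high high_partialE; exact: bounded_cvg (high_fourier_bounded x).
Qed.

Lemma fourier_high x k : K k -> fourier (high x) k = high_fourier x k.
Proof.
by move=> Kk; apply: (ip_limit Hip Hb) => //; rewrite -high_partialE; exact: high_cvg.
Qed.

Lemma high_norm_le x : `|high x| <= `|x|.
Proof.
rewrite -(@ler_pXn2r _ 2)// ?nnegrE//.
apply: (parseval_le Hip Hb); apply: bounded_sums_eq (high_fourier_bounded x) => k Kk.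
by rewrite fourier_high.
Qed.

Lemma highB x y : high (x - y) = high x - high y.
Proof.
apply: fourier_inj => k Kk; rewrite fourierB !fourier_high// /high_fourier fourierB.
by case: ifP; rewrite ?subr0.
Qed.

Lemma highZ a x : high (a *: x) = a *: high x.
Proof.
apply: fourier_inj => k Kk; rewrite fourierZ !fourier_high// /high_fourier fourierZ.
by case: ifP; rewrite ?mulr0.
Qed.

Lemma high_continuous : continuous high.
Proof.
move=> x; apply/cvgrPdist_lt => d d0.
have /cvgrPdist_lt/(_ d d0) := @cvg_id _ (nbhs x).
by apply: filterS => y; apply: le_lt_trans; rewrite -highB high_norm_le.
Qed.

(** A self-adjoint operator has its adjoint's domain, so it is enough to exhibit
    [w], namely the projection of [A x], with
    [ip (A v) (high x) = ip v w] on the domain. *)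
Lemma high_DA x : DA x -> DA (high x).
Proof.
have [_ _ DAE sym] := HA; move=> xD; rewrite DAE; exists (high (A x)) => v vD.
apply: ip_eq_fourier => k Kk; rewrite !fourier_high// fourier_A// /high_fourier fourier_A//.
by case: ifP => _; ring.
Qed.

Lemma high_hderiv (f : R -> H) t : 0 <= t -> hderivable f t ->
  hderivable (high \o f) t /\ hderiv (high \o f) t = high (hderiv f t).
Proof.
apply: hderiv_linear.
- by move=> x y; exact: highB.
- by move=> a x; exact: highZ.
- exact: high_continuous.
Qed.

Lemma high_hderiv2 (f : R -> H) t : (forall s, 0 <= s -> hderivable f s) ->
  (forall s, 0 <= s -> hderivable (hderiv f) s) -> 0 <= t ->
  hderiv (hderiv (high \o f)) t = high (hderiv (hderiv f) t).
Proof.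
move=> d1 d2 t0; have [d <-] := high_hderiv t0 (d2 t t0).
have E s : 0 <= s -> (high \o hderiv f) s = hderiv (high \o f) s.
  by move=> s0; have [_ ->] := high_hderiv s0 (d1 s s0).
by have [_ ->] := hderiv_ext t0 E d.
Qed.


(** The projection removes the modes below [lam], on which no decay estimate is
    available. *)
Lemma weighted_pow_high w s x Q d G : 0 < w -> 0 <= Q ->
  (forall k, K k -> 0 <= d k) -> bounded_sums K d G ->
  (forall k, K k -> lam <= lambda k ->
     w * (mu k `^ s * fourier x k) ^+ 2 <= Q * d k) ->
  w * `|pow_op ip K e lambda s (high x)| ^+ 2 <= Q * G.
Proof.
move=> w0 Q0 d0 dG h; apply: (weighted_pow_op w0 _ Q0 dG) => k Kk.
rewrite fourier_high// /high_fourier; case: ifP => kl; first exact: h.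
by rewrite mulr0 expr0n /= mulr0 mulr_ge0// d0.
Qed.

Lemma weighted_high w x Q d G : 0 < w -> 0 <= Q ->
  (forall k, K k -> 0 <= d k) -> bounded_sums K d G ->
  (forall k, K k -> lam <= lambda k -> w * fourier x k ^+ 2 <= Q * d k) ->
  w * `|high x| ^+ 2 <= Q * G.
Proof.
move=> w0 Q0 d0 dG h; apply: (weighted_parseval w0 _ Q0 dG) => k Kk.
rewrite fourier_high// /high_fourier; case: ifP => kl; first exact: h.
by rewrite expr0n /= mulr0 mulr_ge0// d0.
Qed.

End Operators.

(** * The modes of the Kirchhoff equation *)

Section Solution.
Context (R : realType) (H : completeNormedModType R) (ip : {dot H for idfun}).
Context (Hip : norm_from_ip ip).
Context (DA : set H) (A : H -> H) (K : pred nat) (e : nat -> H) (lambda : nat -> R).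
Context (HA : self_adjoint ip DA A) (He : eigenbasis ip K e lambda DA A).
Let Hb : orthonormal_basis ip K e := He.1.
Local Notation fourier := (fourier_coef ip e).
Local Notation mu k := (lambda k ^+ 2).
Local Notation half := (pow_op ip K e lambda (1/2)).
Context (lam gam eps K1 K2 : R) (u0 u1 : H) (u Theta : R -> H).
Context (Hgam : 0 < gam) (HK1 : 0 < K1) (HK2 : 0 < K2) (He0 : 0 < eps).
Context (Hu0 : DA u0).
Context (Hs : solution ip K e lambda DA A gam eps u0 u1 u).
Context (Hd : decay ip K e lambda A gam K1 K2 u).
Context (Hc : corrector ip K e lambda A gam lam eps u0 u1 Theta).
Local Notation high := (high ip K e lambda lam).
Local Notation b := (fun t => kirchhoff ip K e lambda gam (u t)).

Definition kirchhoff_deriv (t : R) : R :=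
  (gam * ip (half (u t)) (half (u t)) `^ (gam - 1)) *
  (2 * ip (half (u t)) (hderiv (half \o u) t)).

Lemma kirchhoffE (v : H) :
  kirchhoff ip K e lambda gam v = ip (half v) (half v) `^ gam.
Proof. by rewrite /kirchhoff powRrM powR_mulrn// Hip. Qed.

Lemma half_sqrE t : 0 <= t ->
  ip (half (u t)) (half (u t)) = ip (A (u t)) (u t).
Proof.
move=> t0; have [[_ [c1 _ _] [dD _ _]] _ _ _] := Hs.
by have [us _ _ _ _] := c1 t t0; apply: (ip_half_power Hip HA He) => //; exact: dD.
Qed.

Lemma half_sqr_gt0 t : 0 <= t -> 0 < ip (half (u t)) (half (u t)).
Proof.
move=> t0; have [/andP[h _] _ _] := Hd t0; rewrite -Hip; apply: lt_le_trans h.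
by rewrite mulr_gt0 ?powR_gt0//; lra.
Qed.

(** Continuity up to 0 is read off [ip (A u) u], since [u] is continuous with
    values in [D(A)], and the derivative off [A^(1/2) u], which is [C^1]. *)
Lemma half_sqr_evolves : evolves (fun t => ip (half (u t)) (half (u t)) : R)
  (fun t => 2 * ip (half (u t)) (hderiv (half \o u) t)).
Proof.
have [[_ [c1 _ _] [_ cu cAu]] _ _ _] := Hs.
have dq t : 0 <= t -> hderivable (half \o u) t.
  by move=> t0; have [] := c1 t t0.
apply: evolves_hderiv => t t0.
- rewrite half_sqrE//.
  have c : (fun s => ip (A (u s)) (u s)) @ within (@half_line R) (nbhs t)
     --> ip (A (u t)) (u t).
    by apply: (cvg_ip Hip); [exact: (C0_cvg cAu)|exact: C0_cvg].
  apply: cvg_trans c; apply: near_eq_cvg; rewrite /within /=.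
  apply: (@filterS _ (nbhs t) _ setT); last exact: filterT.
  move=> s _; rewrite /half_line /= in_itv /= andbT => s0.
  by rewrite half_sqrE.
- by have [] := hderiv_sqr Hip t0 (dq t t0).
- by have [] := hderiv_sqr Hip (ltW t0) (dq t (ltW t0)).
Qed.

Lemma kirchhoff_evolves : evolves b kirchhoff_deriv.
Proof.
have := evolves_comp (h := fun x : R => x `^ gam)
  (h' := fun x : R => gam * x `^ (gam - 1)) _ half_sqr_evolves.
have -> : b = (fun t => ip (half (u t)) (half (u t)) `^ gam).
  by apply/funext => t; exact: kirchhoffE.
by apply => t t0; apply: is_derive1_powR; exact: half_sqr_gt0.
Qed.

(** The ratio [|b'| / b = 2 gam |<A u, u'>| / |A^(1/2) u|^2] is at most
    [2 gam (K2 / K1) / (1 + t)], and [1 / (1 + t) <= b / K1^gam]. *)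
Definition kirchhoff_var : R := 2 * gam * (K2 / K1) / (K1 `^ gam).

Lemma powR_rate (t : R) : 0 <= t ->
  (1 + t) `^ (- (1 / gam)) `^ gam = (1 + t)^-1.
Proof.
move=> t0; rewrite -powRrM mulNr mulfVK ?gt_eqF//.
by rewrite powR_inv1//; lra.
Qed.

Lemma powR_rate2 (t : R) : 0 <= t ->
  (1 + t) `^ (- 2 - 1 / gam) = (1 + t) `^ (- (1 / gam)) / (1 + t) ^+ 2.
Proof.
move=> t0; rewrite powRD; last by apply/implyP => _; rewrite gt_eqF//; lra.
by rewrite powR_invn 1?mulrC//; lra.
Qed.

(** The decay exponents are tuned for this: [(1 + t)^(- 1 / gam)] to the power
    [gam] is [1 / (1 + t)], while in [|<A u, u'>| / |A^(1/2) u|^2] the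
    powers [(1 + t)^(- 1 / gam)] cancel and the factor [1 / (1 + t)] of [|u'|]
    remains. *)
Lemma kirchhoff_damping : damping (K1 `^ gam) (K2 `^ gam) kirchhoff_var
  b kirchhoff_deriv (primitive b).
Proof.
have K1g : 0 < K1 `^ gam by exact: powR_gt0.
have low t : 0 <= t -> K1 `^ gam / (1 + t) <= b t.
  move=> t0; have [/andP[h _] _ _] := Hd t0; rewrite kirchhoffE.
  rewrite -powR_rate// -powRM ?powR_ge0 ?(ltW HK1)//.
  apply: ge0_ler_powR; rewrite ?nnegrE ?(ltW Hgam)//.
  - by rewrite mulr_ge0 ?powR_ge0// ltW.
  - exact/ltW/half_sqr_gt0.
  - by rewrite -Hip.
split=> //.
- exact: powR_gt0.
- by rewrite /kirchhoff_var; nonneg.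
- move=> t t0; have [/andP[_ h] _ _] := Hd t0; rewrite kirchhoffE.
  rewrite -powR_rate// -powRM ?powR_ge0 ?(ltW HK2)//.
  apply: ge0_ler_powR; rewrite ?nnegrE ?(ltW Hgam)//.
  - exact/ltW/half_sqr_gt0.
  - by rewrite mulr_ge0 ?powR_ge0// ltW.
  - by rewrite -Hip.
- move=> t t0; have t0' := ltW t0; have [/andP[h _] /andP[_ hA] hu] := Hd t0'.
  have q0 := half_sqr_gt0 t0'; have lb := low t t0'.
  rewrite Hip in h; rewrite powR_rate2// in hu.
  have bE : b t = ip (half (u t)) (half (u t)) `^ gam by exact: kirchhoffE.
  have s0 : 0 < (1 + t) `^ (- (1 / gam)) by rewrite powR_gt0//; lra.
  have [[_ [c1 _ _] [dD _ _]] _ _ _] := Hs.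
  have [us us' _ _ dE] := c1 t t0'.
  rewrite /kirchhoff_deriv dE (ip_half_power Hip HA He (dD t t0') us us').
  set q := ip (half _) _ in q0 h bE *; set r := (1 + t) `^ _ in s0 h hA hu.
  have bq : q `^ (gam - 1) = b t / q.
    rewrite bE powRB; last by apply/implyP => _; rewrite gt_eqF.
    by rewrite powRr1// ltW.
  have t1 : 0 < 1 + t by lra.
  have prod : `|A (u t)| * `|hderiv u t| <= K2 * r / (1 + t).
    rewrite -(@ler_pXn2r _ 2)// ?nnegrE.
    + rewrite exprMn; apply: le_trans (ler_pM _ _ hA hu) _; try exact: sqr_ge0.
      by rewrite le_eqVlt; apply/orP; left; apply/eqP; field; rewrite gt_eqF.
    + by apply: mulr_ge0.
    + by nonneg.
  have cs := le_trans (cauchy_schwarz Hip _ _) prod.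
  have b0 : 0 < b t by rewrite bE powR_gt0.
  rewrite bq !normrM (ger0_norm (ltW Hgam)) (ger0_norm (ltW b0)) normfV.
  rewrite (ger0_norm (ltW q0)) ger0_norm//.
  apply: le_trans (_ : gam * (b t / q) * (2 * (K2 * r / (1 + t))) <= _).
    by apply: ler_wpM2l; [nonneg|rewrite ler_pM2l].
  apply: le_trans (_ : gam * (b t / (K1 * r)) * (2 * (K2 * r / (1 + t))) <= _).
    apply: ler_wpM2r; first by nonneg.
    rewrite ler_pM2l// ler_pM2l// lef_pV2 ?posrE//.
    by rewrite mulr_gt0.
  have -> : gam * (b t / (K1 * r)) * (2 * (K2 * r / (1 + t))) =
      2 * gam * (K2 / K1) * b t / (1 + t) by field; rewrite !gt_eqF.
  have -> : kirchhoff_var * b t ^+ 2 =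
    2 * gam * (K2 / K1) * b t * (b t / K1 `^ gam).
    by rewrite /kirchhoff_var; field; rewrite !gt_eqF.
  apply: ler_wpM2l; first by nonneg.
  by rewrite ler_pdivlMr// mulrC.
- exact: kirchhoff_evolves.
- by apply: evolves_primitive => t t0; case: kirchhoff_evolves => _; apply.
- exact: primitive0.
Qed.

Local Notation y k := (fun t => fourier (u t) k).
Local Notation y1 k := (fun t => fourier (hderiv u t) k).

Lemma fourier_hderiv (f : R -> H) k t : 0 <= t -> hderivable f t ->
  hderivable (fun s => fourier (f s) k) t /\
  hderiv (fun s => fourier (f s) k) t = fourier (hderiv f t) k.
Proof.
move=> t0 df; apply: (hderiv_linear (L := fun x => fourier x k)) => //.
- by move=> v w; exact: fourierB.
- by move=> a v; exact: fourierZ.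
- exact: fourier_continuous.
Qed.

Lemma fourier_evolves (f : R -> H) (g : R -> R) k : is_C0 f ->
  (forall t, 0 <= t -> hderivable f t) ->
  (forall t, 0 < t -> fourier (hderiv f t) k = g t) ->
  evolves (fun t => fourier (f t) k) g.
Proof.
move=> cf df E; apply: evolves_hderiv => t t0.
- by apply: (cvg_ip Hip); [exact: C0_cvg|exact: cvg_cst].
- by have [] := fourier_hderiv k t0 (df t t0).
- by have [_ ->] := fourier_hderiv k (ltW t0) (df t (ltW t0)); exact: E.
Qed.

(** The equation, tested on an eigenvector; it also holds at time 0, where it
    provides the initial acceleration. *)
Lemma solution_acceleration k t : K k -> 0 <= t ->
  fourier (hderiv (hderiv u) t) k = acceleration eps (mu k) b (y k) (y1 k) t.
Proof.
move=> Kk t0; have [[_ _ [dD _ _]] eq _ _] := Hs.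
have := congr1 (fun x => fourier x k) (eq t t0).
rewrite !fourierD !fourierZ (fourier_A HA He)//; last exact: dD.
have -> : fourier 0 k = 0 by rewrite /fourier_coef linear0l.
move=> E; rewrite /acceleration; apply: (mulfI (lt0r_neq0 He0)).
rewrite mulrCA mulfV ?gt_eqF// mulr1; lra.
Qed.

Lemma solution_mode k : K k -> mode eps (mu k) b (y k) (y1 k).
Proof.
move=> Kk; have [[[[d1 _] [d2 _]] _ [_ cu _]] _ _ _] := Hs.
have [[_ [_ c1 _] _] _ _ _] := Hs.
split; apply: fourier_evolves => // t t0.
exact/(solution_acceleration Kk)/ltW.
Qed.

Lemma solution_high_hderiv t : 0 <= t ->
  hderiv (fun s => high (u s)) t = high (hderiv u t).
Proof.
move=> t0; have [[[[d1 _] _] _ _] _ _ _] := Hs.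
by have [_] := high_hderiv Hip He lam t0 (d1 t t0).
Qed.

Lemma solution_high_hderiv2 t : 0 <= t ->
  hderiv (hderiv (fun s => high (u s))) t = high (hderiv (hderiv u) t).
Proof.
move=> t0; have [[[[d1 _] [d2 _]] _ _] _ _ _] := Hs.
exact: (high_hderiv2 Hip He lam d1 d2 t0).
Qed.

(** The mode of [Theta''], expressed through [Theta'] by means of the equation
    [eps Theta'' + Theta' = 0] because [Theta'] is what can be differentiated
    again. *)
Definition corrector_mode k t : R := - eps^-1 * fourier (hderiv Theta t) k.
Definition corrector_mode' k t : R :=
  - eps^-1 * fourier (hderiv (hderiv Theta) t) k.

Lemma fourier_corrector k t : 0 <= t ->
  fourier (hderiv (hderiv Theta) t) k = corrector_mode k t.
Proof.
move=> t0; have [_ eq _ _] := Hc.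
have := congr1 (fun x => fourier x k) (eq t t0).
rewrite !fourierD !fourierZ; have -> : fourier 0 k = 0.
  by rewrite /fourier_coef linear0l.
move=> E; rewrite /corrector_mode; apply: (mulfI (lt0r_neq0 He0)).
rewrite mulNr mulrN mulVKf ?gt_eqF//; lra.
Qed.

Lemma corrector_mode_evolves k :
  evolves (corrector_mode k) (corrector_mode' k).
Proof.
have [[[[d1 c1] [d2 _]] _] _ _ _] := Hc.
by apply: evolvesZ; apply: fourier_evolves.
Qed.

Lemma corrector_mode_eq k t : 0 < t ->
  eps * corrector_mode' k t + corrector_mode k t = 0.
Proof.
move=> t0; rewrite -fourier_corrector; last exact: ltW.
by rewrite /corrector_mode' mulNr mulrN mulVKf ?gt_eqF// addNr.
Qed.

(** The initial velocity of the corrector is chosen so that its initial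
    acceleration is that of the solution. *)
Lemma corrector_mode0 k : K k -> corrector_mode k 0 =
  if lam <= lambda k then
    acceleration eps (mu k) b (fun t => fourier (u t) k)
      (fun t => fourier (hderiv u t) k) 0
  else 0.
Proof.
move=> Kk; have [_ _ _ d0] := Hc; have [_ _ uE dE] := Hs.
rewrite /corrector_mode d0 fourierD fourierZ (fourier_A HA He)//; last first.
  exact: (high_DA Hip HA He).
rewrite !(fourier_high Hip He lam)// /high_fourier; case: ifP => _.
  by rewrite /acceleration uE dE; field; rewrite gt_eqF.
by rewrite !mulr0 addr0 mulr0.
Qed.

(** An initial value 0 is preserved, by [relaxation_bound] with zero forcing. *)
Lemma corrector_mode_low k t : K k -> lambda k < lam -> 0 <= t ->
  corrector_mode k t = 0.
Proof.
move=> Kk kl t0.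
have := @relaxation_bound _ eps 0 _ _ (fun=> 1) (fun=> 0) He0 (lexx 0)
  (corrector_mode_evolves k) _ t t0.
rewrite corrector_mode0// [lam <= _]leNgt kl /= expr0n /= mulr0 addr0 => h.
apply/eqP; rewrite -sqrf_eq0 eq_le sqr_ge0 andbT; apply: h => s s0.
by split; [rewrite mul1r corrector_mode_eq|lra|].
Qed.

Lemma weighted_remainder w Q d G t : 0 <= t -> 0 < w -> 0 <= Q ->
  (forall k, K k -> 0 <= d k) -> bounded_sums K d G ->
  (forall k, K k -> lam <= lambda k ->
     w * (acceleration eps (mu k) b (fun t => fourier (u t) k)
      (fun t => fourier (hderiv u t) k) t - corrector_mode k t) ^+ 2 <= Q * d k) ->
  w * `|hderiv (hderiv (fun s => high (u s))) t
      - hderiv (hderiv Theta) t| ^+ 2 <= Q * G.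
Proof.
move=> t0 w0 Q0 d0 dG h; rewrite solution_high_hderiv2//.
apply: (weighted_parseval Hip He w0 _ Q0 dG) => k Kk.
rewrite fourierB (fourier_high Hip He lam)// /high_fourier fourier_corrector//.
have [kl|kl] := leP lam (lambda k).
  by rewrite solution_acceleration//; exact: h.
by rewrite corrector_mode_low// subr0 expr0n /= mulr0 mulr_ge0// d0.
Qed.

End Solution.

(** * Decay of the high-frequency components *)

Theorem theorem2p1 (R : realType) (H : completeNormedModType R)
  (ip : {dot H for idfun}) (DA : set H) (A : H -> H)
  (K : pred nat) (e : nat -> H) (lambda : nat -> R)
  (gam nu lam : R) (u0 u1 : H)
  (eps1 K1 K2 : R) (u Theta : R -> R -> H)
  (Hip : norm_from_ip ip)
  (HA : self_adjoint ip DA A)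
  (HAco : coercive ip DA A)
  (He : eigenbasis ip K e lambda DA A)
  (Hgam : 0 < gam)
  (Hu0 : DA u0) (Hu1 : pow_dom ip K e lambda (1/2) u1) (Hu00 : u0 != 0)
  (Hnu : frequencies ip K e lambda u0 u1 nu /\
         lbound (frequencies ip K e lambda u0 u1) nu)
  (Hlam : nu <= lam)
  (Heps1 : 0 < eps1 <= 1) (HK1 : 0 < K1) (HK2 : 0 < K2)
  (* u eps is the global solution, with the known uniform decay estimates *)
  (Hu : forall eps : R, 0 < eps <= eps1 ->
     solution ip K e lambda DA A gam eps u0 u1 (u eps) /\
     decay ip K e lambda A gam K1 K2 (u eps))
  (HTheta : forall eps : R, 0 < eps <= eps1 ->
     corrector ip K e lambda A gam lam eps u0 u1 (Theta eps)) :
  let Apow := pow_op ip K e lambda in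
  let U (eps t : R) := high ip K e lambda lam (u eps t) in
  let b (eps t : R) := kirchhoff ip K e lambda gam (u eps t) in
  let B (eps t : R) := primitive (b eps) t in
  exists eps0 : R, 0 < eps0 <= eps1 /\
  [/\
      forall h : nat, (h <= 1)%N -> exists g : R,
        forall eps : R, 0 < eps <= eps0 -> forall t : R, 0 <= t ->
        expR (2 * lam ^+ 2 * B eps t) *
          (eps * (`|Apow (h%:R / 2) (hderiv (U eps) t)| ^+ 2 / b eps t)
           + `|Apow (h.+1%:R / 2) (U eps t)| ^+ 2) <= g,
      exists g : R,
        forall eps : R, 0 < eps <= eps0 -> forall t : R, 0 <= t ->
        expR (2 * lam ^+ 2 * B eps t) *
          (`|hderiv (U eps) t| ^+ 2 / b eps t ^+ 2) <= g,
      forall eps : R, 0 < eps <= eps0 -> exists g : R, forall t : R, 0 <= t ->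
        expR (2 * lam ^+ 2 * B eps t) *
          (`|hderiv (hderiv (U eps)) t - hderiv (hderiv (Theta eps)) t| ^+ 2
           / b eps t ^+ 4) <= g &
      pow_dom ip K e lambda 2 u0 -> pow_dom ip K e lambda (3/2) u1 ->
        exists g : R,
        forall eps : R, 0 < eps <= eps0 -> forall t : R, 0 <= t ->
        expR (2 * lam ^+ 2 * B eps t) *
          (`|hderiv (hderiv (U eps)) t - hderiv (hderiv (Theta eps)) t| ^+ 2
           / b eps t ^+ 4) <= g].
Proof.
move=> Apow U b B.
pose kap := K1 `^ gam; pose bet := K2 `^ gam; pose C := kirchhoff_var gam K1 K2.
(* p is the extra decay that makes expB_growth applicable. *)
pose m := lam ^+ 2; pose p := 2 / kap.
have kap0 : 0 < kap by exact: powR_gt0.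
have bet0 : 0 < bet by exact: powR_gt0.
have C0 : 0 <= C by rewrite /C /kirchhoff_var; nonneg.
have lam0 : 0 < lam.
  apply: lt_le_trans Hlam; have [[k [Kk _] <-] _] := Hnu.
  by have [_ /(_ k Kk)[]] := He.
have m0 : 0 < m by exact: exprn_gt0.
have p0 : 0 < p by exact: divr_gt0.
have pk : 2 <= p * kap by rewrite /p mulfVK// gt_eqF.
(* eps0 depends on lam through m: small_eps is required at the level m + p. *)
pose L := (m + p) * bet + C * bet + bet.
have L0 : 0 < L by rewrite /L; nra.
have /andP[e10 e11] := Heps1.
pose eps0 := Num.min eps1 (16 * L)^-1.
have eps00 : 0 < eps0 by rewrite lt_min e10 invr_gt0 mulr_gt0.
have eps01 : eps0 <= eps1 by rewrite ge_min lexx.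
exists eps0; split; first by rewrite eps00.
have range (eps : R) : 0 < eps <= eps0 -> 0 < eps <= eps1.
  by move=> /andP[-> h]; exact: le_trans eps01.
have small' (eps : R) : 0 < eps <= eps0 -> small_eps (m + p) bet C eps.
  move=> ee; have /andP[x0 xe] := ee; have /andP[_ x1] := range eps ee.
  have : eps <= (16 * L)^-1 by apply: le_trans xe _; rewrite ge_min lexx orbT.
  rewrite -[_^-1]mul1r ler_pdivlMr ?mulr_gt0// => xL.
  have [h1 [h2 h3]] : [/\ 0 <= eps * ((m + p) * bet), 0 <= eps * (C * bet) &
      0 <= eps * bet] by split; nonneg; lra.
  have xL' : 16 * (eps * ((m + p) * bet) + eps * (C * bet) + eps * bet) <= 1.
    by apply: le_trans xL; rewrite /L; lra.
  by split; [apply/andP; split => //; exact: le_trans e11| | |]; lra.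
have eps_le1 (eps : R) : 0 < eps <= eps0 -> eps <= 1.
  by move=> /range/andP[_ h]; exact: le_trans e11.
pose b0 := kirchhoff ip K e lambda gam u0; pose Q := energy_const bet C m b0.
pose f0 k := fourier_coef ip e u0 k; pose f1 k := fourier_coef ip e u1 k.
have damp (eps : R) : 0 < eps <= eps0 ->
    damping kap bet C (b eps)
      (kirchhoff_deriv ip K e lambda gam (u eps)) (primitive (b eps)).
  by move=> /range/Hu[]; exact: kirchhoff_damping.
have b0E (eps : R) : 0 < eps <= eps0 -> b eps 0 = b0.
  by move=> /range/Hu[[_ _ uE _] _]; rewrite /b uE.
have b0_gt0 : 0 < b0.
  have ee : 0 < eps0 <= eps0 by rewrite eps00 lexx.
  by rewrite -(b0E _ ee); exact: damping_gt0 (damp _ ee) _ (lexx 0).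
have Q0 : 0 <= Q.
  have ee : 0 < eps0 <= eps0 by rewrite eps00 lexx.
  by rewrite /Q -(b0E _ ee); exact: energy_const_ge0 (damp _ ee) _ m0.
have small (eps : R) : 0 < eps <= eps0 -> small_eps m bet C eps.
  by move=> ee; apply: (small_epsS (damp _ ee) _ (small' _ ee)); lra.
pose y eps k t := fourier_coef ip e (u eps t) k.
pose y1 eps k t := fourier_coef ip e (hderiv (u eps) t) k.
have modeE (eps : R) k : 0 < eps <= eps0 -> K k ->
    [/\ mode eps (lambda k ^+ 2) (b eps) (y eps k) (y1 eps k),
        y eps k 0 = f0 k & y1 eps k 0 = f1 k].
  move=> ee Kk; have [Hs _] := Hu _ (range _ ee); have /andP[ee0 _] := ee.
  split; first exact: (solution_mode Hip HA He ee0 Hs Kk).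
  - by have [_ _ uE _] := Hs; rewrite /y uE.
  - by have [_ _ _ uE] := Hs; rewrite /y1 uE.
have mmu k : lam <= lambda k -> m <= lambda k ^+ 2.
  by move=> kl; rewrite lerXn2r ?nnegrE//; lra.
(* s1 and s0 translate the regularity of u1 and u0 into summability. *)
have s1 i : (i <= 1)%N -> summable_modes K (fun k => lambda k ^+ 2 ^+ i * f1 k ^+ 2).
  by move=> i1; apply: (summable_lower Hip He i1); exact: (summable_pow Hip He).
have s0 i : (i <= 2)%N -> summable_modes K (fun k => lambda k ^+ 2 ^+ i * f0 k ^+ 2).
  by move=> i1; apply: (summable_lower Hip He i1); exact: (summable_dom Hip HA He).
have mu0 k : 0 <= lambda k ^+ 2 by exact: sqr_ge0.
have energy (eps : R) k (t : R) : 0 < eps <= eps0 -> 0 <= t -> K k -> lam <= lambda k ->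
    expR (2 * m * B eps t) *
      (eps * (y1 eps k t ^+ 2 / b eps t) + lambda k ^+ 2 * y eps k t ^+ 2) <=
    Q * (f1 k ^+ 2 + lambda k ^+ 2 * f0 k ^+ 2).
  move=> ee t0 Kk kl; have [Hm yE y1E] := modeE _ _ ee Kk.
  have mm : 0 < m <= lambda k ^+ 2 by rewrite m0 mmu.
  apply: le_trans (mode_energy_bound (damp _ ee) (small _ ee) mm Hm t0) _.
  rewrite (b0E _ ee) -/Q yE y1E; apply: ler_wpM2l => //; rewrite lerD2r.
  by rewrite -[leRHS]mul1r; apply: ler_wpM2r; [exact: sqr_ge0|exact: eps_le1].
have E0 eps t : 0 < expR (2 * m * B eps t) by exact: expR_gt0.
split.
- move=> h h1.
  have [G dG] := summable_modesD (s1 h h1) (s0 h.+1 h1).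
  have d0 k : K k -> 0 <= lambda k ^+ 2 ^+ h * f1 k ^+ 2
      + lambda k ^+ 2 ^+ h.+1 * f0 k ^+ 2.
    by move=> _; nonneg.
  exists (Q * G + Q * G) => eps ee t t0; have [Hs _] := Hu _ (range _ ee).
  have /andP[ee0 _] := ee; have bt0 := damping_gt0 (damp _ ee) t0.
  have mh k : K k -> lam <= lambda k -> lambda k ^+ 2 ^+ h * (expR (2 * m * B eps t) *
      (eps * (y1 eps k t ^+ 2 / b eps t) + lambda k ^+ 2 * y eps k t ^+ 2)) <=
      Q * (lambda k ^+ 2 ^+ h * f1 k ^+ 2 + lambda k ^+ 2 ^+ h.+1 * f0 k ^+ 2).
    move=> Kk kl; have := energy eps k t ee t0 Kk kl.
    move=> /(ler_wpM2l (exprn_ge0 h (mu0 k))) /le_trans; apply.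
    by rewrite [_ ^+ h.+1]exprSr le_eqVlt; apply/orP; left; apply/eqP; ring.
  rewrite mulrDr; apply: lerD.
    rewrite (solution_high_hderiv Hip He lam Hs t0).
    rewrite [leLHS](_ : _ = expR (2 * m * B eps t) * eps / b eps t *
      `|Apow (h%:R / 2) (high ip K e lambda lam (hderiv (u eps) t))| ^+ 2); last first.
      by rewrite /m; ring.
    apply: (weighted_pow_high Hip He _ Q0 d0 dG).
      by rewrite divr_gt0// mulr_gt0.
    move=> k Kk kl; apply: le_trans (mh k Kk kl).
    rewrite exprMn (sqr_half_pow He)// -/(y1 eps k t).
    rewrite [leLHS](_ : _ = lambda k ^+ 2 ^+ h * (expR (2 * m * B eps t) *
      (eps * (y1 eps k t ^+ 2 / b eps t)))); last by ring.
    apply: ler_wpM2l; first exact: exprn_ge0.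
    by rewrite ler_pM2l// lerDl; nonneg.
  apply: (weighted_pow_high Hip He (E0 eps t) Q0 d0 dG) => k Kk kl.
  apply: le_trans (mh k Kk kl).
  rewrite exprMn (sqr_half_pow He)// -/(y eps k t).
  rewrite [leLHS](_ : _ = lambda k ^+ 2 ^+ h * (expR (2 * m * B eps t) *
      (lambda k ^+ 2 * y eps k t ^+ 2))); last by rewrite [_ ^+ h.+1]exprSr; ring.
  apply: ler_wpM2l; first exact: exprn_ge0.
  by rewrite ler_pM2l// lerDr; nonneg.
- have [G dG] := summable_modesD (summable_modesD (s1 0%N isT) (s1 1%N isT)) (s0 2%N isT).
  exists ((b0 ^- 2 + 4 * Q) * G) => eps ee t t0; have [Hs _] := Hu _ (range _ ee).
  have /andP[ee0 _] := ee; have bt0 := damping_gt0 (damp _ ee) t0.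
  rewrite (solution_high_hderiv Hip He lam Hs t0).
  rewrite [leLHS](_ : _ = expR (2 * m * B eps t) / b eps t ^+ 2 *
    `|high ip K e lambda lam (hderiv (u eps) t)| ^+ 2); last by rewrite /m; ring.
  have b02 : 0 <= b0 ^- 2 by rewrite invr_ge0; nonneg.
  apply: (weighted_high Hip He _ _ _ dG).
  - by rewrite divr_gt0// exprn_gt0.
  - by nonneg.
  - by move=> k _; nonneg.
  move=> k Kk kl; have [Hm yE y1E] := modeE _ _ ee Kk.
  have mm : 0 < m <= lambda k ^+ 2 by rewrite m0 mmu.
  have := mode_velocity_bound (damp _ ee) (small _ ee) mm Hm t0.
  rewrite (b0E _ ee) -/Q yE y1E => V.
  rewrite [leLHS](_ : _ = expR (2 * m * B eps t) *
    (y1 eps k t ^+ 2 / b eps t ^+ 2)); last by rewrite /y1; ring.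
  apply: le_trans V _; rewrite expr0 mul1r expr1.
  have f10 : 0 <= f1 k ^+ 2 by exact: sqr_ge0.
  have f11 : 0 <= lambda k ^+ 2 * f1 k ^+ 2 by nonneg.
  have f02 : 0 <= lambda k ^+ 2 ^+ 2 * f0 k ^+ 2 by nonneg.
  rewrite [leRHS]mulrDl; apply: lerD.
    by rewrite mulrC; apply: ler_wpM2l => //; lra.
  rewrite -[leRHS]mulrA ler_pM2l//; apply: ler_wpM2l => //.
  have ef : eps * (lambda k ^+ 2 * f1 k ^+ 2) <= lambda k ^+ 2 * f1 k ^+ 2.
    by rewrite -[leRHS]mul1r; apply: ler_wpM2r => //; exact: eps_le1.
  by lra.
- move=> eps ee; have [Hs _] := Hu _ (range _ ee); have Hc := HTheta _ (range _ ee).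
  have /andP[ee0 _] := ee.
  have [q Hq] := mode_acceleration_data_bound (damp _ ee) pk m0 (small' _ ee).
  have [G dG] := summable_modesD (summable_modesD (s1 0%N isT) (s1 1%N isT))
    (summable_modesD (s0 1%N isT) (s0 2%N isT)).
  exists (`|q| * G) => t t0; have bt0 := damping_gt0 (damp _ ee) t0.
  rewrite [leLHS](_ : _ = expR (2 * m * B eps t) / b eps t ^+ 4 *
    `|hderiv (hderiv (U eps)) t - hderiv (hderiv (Theta eps)) t| ^+ 2); last first.
    by rewrite /m; ring.
  apply: (weighted_remainder Hip HA He ee0 Hu0 Hs Hc t0 _ _ _ dG) => //.
  - by rewrite divr_gt0// exprn_gt0.
  - by move=> k _; nonneg.
  move=> k Kk kl; have [Hm yE y1E] := modeE _ _ ee Kk.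
  have th0 := corrector_mode0 Hip HA He ee0 Hu0 Hs Hc Kk; rewrite kl in th0.
  have := Hq _ _ _ _ _ (mmu k kl) Hm (corrector_mode_evolves Hip Hc k)
    (corrector_mode_eq ee0 Hc k) th0 t t0.
  rewrite yE y1E => a; rewrite [leLHS](_ : _ = expR (2 * m * B eps t) *
    ((acceleration eps (lambda k ^+ 2) (b eps) (y eps k) (y1 eps k) t -
      corrector_mode ip e eps (Theta eps) k t) ^+ 2 / b eps t ^+ 4)); last by ring.
  apply: le_trans a _; rewrite !expr0 !mul1r !expr1.
  rewrite [leRHS](_ : _ = `|q| * ((1 + lambda k ^+ 2) * f1 k ^+ 2
    + (lambda k ^+ 2 + lambda k ^+ 2 ^+ 2) * f0 k ^+ 2)); last by ring.
  by apply: ler_wpM2r; [nonneg|exact: ler_norm].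
(* With mu^3 y'(0)^2 and mu^4 y(0)^2 summable, mode_acceleration_bound alone
   gives a constant independent of eps. *)
move=> Hr0 Hr1.
have r1 i : (i <= 3)%N -> summable_modes K (fun k => lambda k ^+ 2 ^+ i * f1 k ^+ 2).
  by move=> i1; apply: (summable_lower Hip He i1); exact: (summable_pow Hip He).
have r0 i : (i <= 4)%N -> summable_modes K (fun k => lambda k ^+ 2 ^+ i * f0 k ^+ 2).
  move=> i1; apply: (summable_lower Hip He i1); apply: (summable_pow Hip He).
  by have -> : 4%:R / 2 = 2 :> R by field.
have [G dG] := summable_modesD
  (summable_modesD (summable_modesD (r1 1%N isT) (r1 2%N isT)) (r1 3%N isT))
  (summable_modesD (r0 2%N isT) (r0 4%N isT)).
exists (8 * (C ^+ 2 * Q + b0 ^- 2 + 4 * Q) * G) => eps ee t t0.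
have [Hs _] := Hu _ (range _ ee); have Hc := HTheta _ (range _ ee).
have /andP[ee0 _] := ee; have bt0 := damping_gt0 (damp _ ee) t0.
rewrite [leLHS](_ : _ = expR (2 * m * B eps t) / b eps t ^+ 4 *
  `|hderiv (hderiv (U eps)) t - hderiv (hderiv (Theta eps)) t| ^+ 2); last first.
  by rewrite /m; ring.
have b02 : 0 <= b0 ^- 2 by rewrite invr_ge0; nonneg.
apply: (weighted_remainder Hip HA He ee0 Hu0 Hs Hc t0 _ _ _ dG) => //.
- by rewrite divr_gt0// exprn_gt0.
- by nonneg.
- by move=> k _; nonneg.
move=> k Kk kl; have [Hm yE y1E] := modeE _ _ ee Kk.
have mm : 0 < m <= lambda k ^+ 2 by rewrite m0 mmu.
have th0 := corrector_mode0 Hip HA He ee0 Hu0 Hs Hc Kk; rewrite kl in th0.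
have := mode_acceleration_bound (damp _ ee) (small _ ee) mm Hm
  (corrector_mode_evolves Hip Hc k) (corrector_mode_eq ee0 Hc k) th0 t0.
rewrite yE y1E (b0E _ ee) -/Q => a.
rewrite [leLHS](_ : _ = expR (2 * m * B eps t) *
    ((acceleration eps (lambda k ^+ 2) (b eps) (y eps k) (y1 eps k) t -
      corrector_mode ip e eps (Theta eps) k t) ^+ 2 / b eps t ^+ 4)); last by ring.
apply: le_trans a _.
set M := lambda k ^+ 2 in mm *; set F1 := f1 k ^+ 2; set F0 := f0 k ^+ 2.
have M0 : 0 <= M by lra.
have [F10 F00] : 0 <= F1 /\ 0 <= F0 by split; exact: sqr_ge0.
pose X := M ^+ 1 * F1 + M ^+ 2 * F1 + M ^+ 3 * F1 + (M ^+ 2 * F0 + M ^+ 4 * F0).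
have MF (i : nat) : 0 <= M ^+ i * F1 /\ 0 <= M ^+ i * F0 by split; nonneg.
have eMF i : eps * (M ^+ i * F1) <= M ^+ i * F1.
  by rewrite -[leRHS]mul1r; apply: ler_wpM2r; [case: (MF i)|exact: eps_le1].
have [[a1 _] [a2 c2] [a3 _] [_ c4]] := And4 (MF 1%N) (MF 2%N) (MF 3%N) (MF 4%N).
have X1 : M * (eps * F1 + M * F0) <= X by have := eMF 1%N; rewrite /X; lra.
have X2 : M ^+ 2 * F1 <= X by rewrite /X; lra.
have X3 : M ^+ 2 * (M * (eps * F1 + M * F0)) <= X.
  by have := eMF 3%N; rewrite /X; lra.
rewrite -[leRHS]mulrA ler_pM2l// -/X.
rewrite [leLHS](_ : _ = C ^+ 2 * Q * (M * (eps * F1 + M * F0)) +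
  b0 ^- 2 * (M ^+ 2 * F1) + 4 * Q * (M ^+ 2 * (M * (eps * F1 + M * F0)))); last by ring.
rewrite [leRHS]mulrDl [(C ^+ 2 * Q + _) * X]mulrDl.
by do ?apply: lerD; apply: ler_wpM2l => //; nonneg.
Qed.
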